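(* Let $\mu\in\mathfrak{M}^1_+(\Omega)$. If $\mu$ is a good measure relative to $g$ for every function $g:\mathbb{R}\to\mathbb{R}$ which is continuous, nondecreasing and vanishes on $(-\infty,0]$, then $\mu\in L^1_\rho(\Omega)$, i.e. $\mu$ is absolutely continuous with respect to Lebesgue measure with a density $f$ satisfying $\int_\Omega|f|\rho\,dx<\infty$.
   Context: $\Omega\subset\mathbb{R}^N$ ($N\ge1$) is a bounded domain, $T>0$, $Q_T=\Omega\times(0,T)$, $\rho(x)=\operatorname{dist}(x,\partial\Omega)$. $\mathfrak{M}^1_+(\Omega)$ is the set of positive Radon measures $\mu$ on $\Omega$ with $\int_\Omega\rho\,d\mu<\infty$; $L^1_\rho(Q_T)$ is the set of measurable $f$ on $Q_T$ with $\iint_{Q_T}|f|\rho<\infty$. $C^{2,1}_{\ell,0}(\overline{Q_T})$ is the space of $C^{2,1}(\overline{Q_T})$ functions vanishing on $\partial\Omega\times[0,T]\cup\overline\Omega\times\{T\}$. For such $g$, $\mu$ is a good measure relative to $g$ if there exists $u\in L^1(Q_T)$ with $g(u)\in L^1_\rho(Q_T)$ and $\iint_{Q_T}(-u\partial_t\zeta-u\Delta\zeta+\zeta g(u))\,dx\,dt=\int_\Omega\zeta(x,0)\,d\mu$ for all $\zeta\in C^{2,1}_{\ell,0}(\overline{Q_T})$ (a weak solution of $\partial_tu-\Delta u+g(u)=0$ in $Q_T$, $u=0$ on $\partial\Omega\times(0,T)$, $u(\cdot,0)=\mu$). *)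

(* Defs.v *)
From HB Require Import structures.
From mathcomp Require Import all_boot all_order all_algebra.
From mathcomp Require Import all_classical all_reals all_analysis.
Set Implicit Arguments. Unset Strict Implicit. Unset Printing Implicit Defensive.
Import Order.TTheory GRing.Theory Num.Theory.
Import numFieldNormedType.Exports.
Local Open Scope classical_set_scope.
Local Open Scope ring_scope.

(* Points of R^N are row vectors 'rV[R]_N (product = Euclidean topology).
   We equip matrices with their Borel sigma-algebra (generated by opens). *)
Section borel_matrix.
Variables (R : realType) (m n : nat).
Definition borel_mx : set (set 'M[R]_(m, n)) := <<s @open 'M[R]_(m, n) >>.
Lemma borel_mxC (A : set 'M[R]_(m, n)) : borel_mx A -> borel_mx (~` A).
Proof. by move=> sGA; rewrite -setTD; exact: sigma_algebraCD. Qed.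
HB.instance Definition _ := @isMeasurable.Build default_measure_display
  'M[R]_(m, n) borel_mx (@sigma_algebra0 _ setT _) borel_mxC
  (@sigma_algebra_bigcup _ setT _).
End borel_matrix.

Section defs.
Variables (R : realType) (N : nat).
Local Notation RN := 'rV[R]_N.

Definition enorm (x : RN) : R := Num.sqrt (\sum_(i < N) x ord0 i ^+ 2).

Definition bounded_domain (Om : set RN) : Prop :=
  Om !=set0 /\ open Om /\ connected Om /\ bounded_set Om.

Definition boundary (Om : set RN) : set RN := closure Om `\` Om.

Definition rho (Om : set RN) (x : RN) : R :=
  inf [set enorm (x - y) | y in boundary Om].

(* lam is (Borel-)Lebesgue measure on R^N: it gives half-open boxes
   their volume (this determines it uniquely on Borel sets). *)
Definition is_lebesgue_RN (lam : {measure set RN -> \bar R}) : Prop :=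
  forall a b : RN, (forall i, a ord0 i <= b ord0 i) ->
    lam [set x | forall i, a ord0 i <= x ord0 i < b ord0 i] =
      (\prod_(i < N) (b ord0 i - a ord0 i))%:E.

(* mu is in M^1_+(Omega): a positive Radon measure on Omega (Borel measure
   carried by Omega, finite on compact subsets of Omega) with int rho dmu < oo *)
Definition M1plus (Om : set RN) (mu : {measure set RN -> \bar R}) : Prop :=
  mu (~` Om) = 0%E /\
  (forall K : set RN, compact K -> K `<=` Om -> (mu K < +oo)%E) /\
  (\int[mu]_(x in Om) (rho Om x)%:E < +oo)%E.

Definition QT (Om : set RN) (T : R) : set (RN * R) := Om `*` `]0, T[.

Definition dxdt (lam : {measure set RN -> \bar R}) :=
  (lam \x (@lebesgue_measure R))%E.

Definition L1rho (Om : set RN) (lam : {measure set RN -> \bar R})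
    (D : set (RN * R)) (h : RN * R -> R) : Prop :=
  measurable_fun D h /\
  (\int[dxdt lam]_(z in D) (`|h z| * rho Om z.1)%:E < +oo)%E.

Definition e_ (i : 'I_N) : RN := delta_mx ord0 i.
Definition dt (f : RN * R -> R) (z : RN * R) : R :=
  derive1 (fun s => f (z.1, s)) z.2.
Definition dx (i : 'I_N) (f : RN * R -> R) (z : RN * R) : R :=
  derive1 (fun s => f (z.1 + s *: e_ i, z.2)) 0.
Definition laplacian (f : RN * R -> R) (z : RN * R) : R :=
  \sum_(i < N) dx i (dx i f) z.

Definition cont_to_closure (D : set (RN * R)) (f : RN * R -> R) : Prop :=
  exists F : RN * R -> R, {within closure D, continuous F} /\
    (forall z, D z -> f z = F z).

Definition C21_closure (D : set (RN * R)) (zeta : RN * R -> R) : Prop :=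
  {within closure D, continuous zeta} /\
  (forall z, D z ->
     derivable (fun s : R => zeta (z.1, s)) z.2 (1 : R) /\
     (forall i, derivable (fun s : R => zeta (z.1 + s *: e_ i, z.2)) (0 : R) (1 : R)) /\
     (forall i j, derivable (fun s : R => dx i zeta (z.1 + s *: e_ j, z.2)) (0 : R) (1 : R))) /\
  cont_to_closure D (dt zeta) /\
  (forall i, cont_to_closure D (dx i zeta)) /\
  (forall i j, cont_to_closure D (dx j (dx i zeta))).

Definition C21_l0 (Om : set RN) (T : R) (zeta : RN * R -> R) : Prop :=
  C21_closure (QT Om T) zeta /\
  (forall x t, boundary Om x -> 0 <= t <= T -> zeta (x, t) = 0) /\
  (forall x, closure Om x -> zeta (x, T) = 0).

Definition good_measure (Om : set RN) (T : R) (lam : {measure set RN -> \bar R})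
    (g : R -> R) (mu : {measure set RN -> \bar R}) : Prop :=
  exists u : RN * R -> R,
    (dxdt lam).-integrable (QT Om T) (fun z => (u z)%:E) /\
    L1rho Om lam (QT Om T) (g \o u) /\
    forall zeta, C21_l0 Om T zeta ->
      (\int[dxdt lam]_(z in QT Om T)
          (- u z * dt zeta z - u z * laplacian zeta z + zeta z * g (u z))%:E
       = \int[mu]_(x in Om) (zeta (x, 0))%:E)%E.

Definition in_L1rho_measure (Om : set RN) (lam : {measure set RN -> \bar R})
    (mu : {measure set RN -> \bar R}) : Prop :=
  exists f : RN -> R,
    measurable_fun Om f /\
    (\int[lam]_(x in Om) (`|f x| * rho Om x)%:E < +oo)%E /\
    (forall A, measurable A -> A `<=` Om -> (mu A = \int[lam]_(x in A) (f x)%:E)%E).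

End defs.

(* Main.v *)
Require Import Defs.
From HB Require Import structures.
From mathcomp Require Import all_boot all_order all_algebra finmap.
From mathcomp Require Import all_classical all_reals all_analysis.
From mathcomp Require Import measurable_realfun ring lra.
Import Order.TTheory GRing.Theory Num.Theory.
Import numFieldNormedType.Exports.
Local Open Scope classical_set_scope.
Local Open Scope ring_scope.
Set Implicit Arguments. Unset Strict Implicit. Unset Printing Implicit Defensive.

(* Let K be a compact Lebesgue-null subset of Om. Choose open neighbourhoods V_n
   of K with |V_n| <= (n+1)^-2 and C^2 cutoffs phi_n supported in V_n and equal
   to 1 on K, and put zeta_n (x, t) = max (phi_n x - M_n t, 0) ^ 3. For M_n large,
   zeta_n lives on E_n = V_n x ]0, 1/M_n[, |h_n| <= 12 M_n there, and
   h_n <= 1/(n+1) everywhere, where h_n = (d/dt + Laplacian) zeta_n.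
   This one-sided bound disposes of the negative part of u, over which g gives
   no control and for which no maximum principle is available in an arbitrary
   bounded domain. For the positive part take g with g s >= 12 M_n s when
   s >= n+1. Testing the equation with zeta_n then gives
     mu K <= |u|_1 / (n+1) + 12 M_n (n+1) |E_n| + 2 int_(E_n) g(u) --> 0.
   Inner regularity of mu turns this into mu << Lebesgue, and the density is
   obtained by Radon-Nikodym on a countable partition of Om into pieces of
   finite mu-measure. *)

(** * Functions of class C^2 in space and C^1 in time *)

(* Of class C^2 for [k = 3]: it serves as the profile of every bump below. *)
Definition ppow (R : realType) (k : nat) (s : R) : R := Num.max s 0 ^+ k.

Lemma ppow_ge0 (R : realType) (k : nat) (s : R) : 0 <= ppow k s.
Proof. by rewrite /ppow exprn_ge0// le_max lexx orbT. Qed.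

Lemma ppow_le0 (R : realType) (k : nat) (s : R) : s <= 0 -> ppow k.+1 s = 0.
Proof. by move=> s0; rewrite /ppow max_r// expr0n. Qed.

Lemma ppow_pos (R : realType) (k : nat) (s : R) : 0 <= s -> ppow k s = s ^+ k.
Proof. by move=> s0; rewrite /ppow max_l. Qed.

Lemma continuous_ppow (R : realType) (k : nat) : continuous (@ppow R k).
Proof.
move=> s; apply: (@continuous_comp _ _ _ (fun s : R => Num.max s 0) (fun y => y ^+ k)).
  apply: (@continuous_max R R id (cst 0)); [exact: cvg_id|exact: cvg_cst].
exact: exprn_continuous.
Qed.

Lemma is_derive_ppow (R : realType) (k : nat) (s : R) :
  is_derive s 1 (ppow k.+2) (k.+2%:R * ppow k.+1 s).
Proof.
have [s0|s0|->] := ltgtP s 0.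
- rewrite (ppow_le0 _ (ltW s0)) mulr0.
  apply: (@near_eq_is_derive _ _ _ (cst 0)) => //.
  near=> z; rewrite /= ppow_le0//; near: z.
  by apply: filterS (lt_nbhsl s0) => z /ltW.
- rewrite (ppow_pos _ (ltW s0)).
  apply: (@near_eq_is_derive _ _ _ (fun z : R => z ^+ k.+2)) => //.
    near=> z; rewrite /= ppow_pos//; near: z.
    by apply: filterS (lt_nbhsr s0) => z /ltW.
  have := @is_deriveX R R id k.+2 s 1 1 (is_derive_id _ _).
  rewrite /GRing.scale/= mulr1.
  by rewrite (_ : id ^+ k.+2 = (fun z : R => z ^+ k.+2))//; apply/funext => z; rewrite exprfctE.
(* At 0 the difference quotient of [ppow k.+2] is exactly the continuous function [ppow k.+1], so
   Caratheodory's criterion applies. *)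
- rewrite ppow_le0// mulr0; apply/is_derive1_caratheodory.
  exists (ppow k.+1); split => [z| |]; last by rewrite ppow_le0.
    rewrite (@ppow_le0 _ k.+1 0)// !subr0.
    have [z0|z0] := leP 0 z; first by rewrite !ppow_pos// exprSr.
    by rewrite !ppow_le0 ?ltW// mul0r.
  exact: continuous_ppow.
Unshelve. all: by end_near. Qed.

Section C21.
Context {R : realType} {N : nat}.
Local Notation RN := 'rV[R]_N.
Implicit Types f g : RN * R -> R.

(** The derivatives are carried as explicit functions on all of R^N x R, so that [dt], [dx] and
    [laplacian] of composites are obtained by rewriting. Space derivatives are taken at 0 along
    coordinate lines, the form in which [dx] is defined. *)
Record C21_data f (ft : RN * R -> R) (fx : 'I_N -> RN * R -> R)
    (fxx : 'I_N -> 'I_N -> RN * R -> R) : Prop := C21Data {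
  C21_cont : continuous f ;
  C21_cont_t : continuous ft ;
  C21_cont_x : forall i, continuous (fx i) ;
  C21_cont_xx : forall i j, continuous (fxx i j) ;
  C21_der_t : forall x t, is_derive t (1 : R) (fun s : R => f (x, s)) (ft (x, t)) ;
  C21_der_x : forall i x t,
    is_derive (0 : R) (1 : R) (fun s : R => f (x + s *: e_ R i, t)) (fx i (x, t)) ;
  C21_der_xx : forall i j x t,
    is_derive (0 : R) (1 : R) (fun s : R => fx i (x + s *: e_ R j, t)) (fxx i j (x, t)) }.

Lemma C21_comp (p p1 p2 : R -> R) f ft fx fxx :
  (forall s, is_derive s (1 : R) p (p1 s)) ->
  (forall s, is_derive s (1 : R) p1 (p2 s)) -> continuous p2 ->
  C21_data f ft fx fxx ->
  C21_data (p \o f) (fun z => p1 (f z) * ft z) (fun i z => p1 (f z) * fx i z)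
    (fun i j z => p2 (f z) * fx j z * fx i z + p1 (f z) * fxx i j z).
Proof.
move=> dp dp1 cp2 [cf ct cx cxx dt_ dx_ dxx].
have cp : continuous p.
  by move=> s; apply/differentiable_continuous/derivable1_diffP; case: (dp s).
have cp1 : continuous p1.
  by move=> s; apply/differentiable_continuous/derivable1_diffP; case: (dp1 s).
have cpf (q : R -> R) : continuous q -> continuous (q \o f).
  by move=> cq z; apply: continuous_comp; [exact: cf|exact: cq].
split.
- exact: cpf.
- by move=> z; apply: cvgM; [exact: cpf|exact: ct].
- by move=> i z; apply: cvgM; [exact: cpf|exact: cx].
- move=> i j z; apply: cvgD.
    apply: cvgM; last exact: cx.
    by apply: cvgM; [exact: cpf|exact: cx].
  by apply: cvgM; [exact: cpf|exact: cxx].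
- by move=> x t; apply: (@is_derive1_comp R p (fun s => f (x, s)) t).
- move=> i x t.
  have dpx : is_derive (f (x + 0 *: e_ R i, t)) (1 : R) p (p1 (f (x, t))).
    by rewrite scale0r addr0; exact: dp.
  exact: (@is_derive1_comp R p (fun s => f (x + s *: e_ R i, t)) 0 _ _ dpx (dx_ i x t)).
- move=> i j x t.
  have d1 : is_derive (0 : R) (1 : R) (p1 \o (fun s => f (x + s *: e_ R j, t)))
      (p2 (f (x, t)) * fx j (x, t)).
    have dpx : is_derive (f (x + 0 *: e_ R j, t)) (1 : R) p1 (p2 (f (x, t))).
      by rewrite scale0r addr0; exact: dp1.
    exact: (is_derive1_comp dpx (dx_ j x t)).
  have d2 := is_deriveM d1 (dxx i j x t).
  refine (is_derive_eq d2 _).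
  by rewrite /= scale0r addr0 /GRing.scale/=; ring.
Qed.

Lemma C21_add f ft fx fxx g gt_ gx gxx :
  C21_data f ft fx fxx -> C21_data g gt_ gx gxx ->
  C21_data (fun z => f z + g z) (fun z => ft z + gt_ z)
    (fun i z => fx i z + gx i z) (fun i j z => fxx i j z + gxx i j z).
Proof.
move=> [cf ct cx cxx dt_ dx_ dxx] [cf' ct' cx' cxx' dt' dx' dxx']; split.
- by move=> z; apply: cvgD; [exact: cf|exact: cf'].
- by move=> z; apply: cvgD; [exact: ct|exact: ct'].
- by move=> i z; apply: cvgD; [exact: cx|exact: cx'].
- by move=> i j z; apply: cvgD; [exact: cxx|exact: cxx'].
- by move=> x t; exact: (is_deriveD (dt_ x t) (dt' x t)).
- by move=> i x t; exact: (is_deriveD (dx_ i x t) (dx' i x t)).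
- by move=> i j x t; exact: (is_deriveD (dxx i j x t) (dxx' i j x t)).
Qed.

Lemma C21_cst (c : R) :
  C21_data (fun=> c) (fun=> 0) (fun _ _ => 0) (fun _ _ _ => 0).
Proof. by split => *; try exact: cvg_cst; exact: is_derive_cst. Qed.

Lemma C21_coord (i : 'I_N) :
  C21_data (fun z => z.1 ord0 i) (fun=> 0) (fun j _ => (j == i)%:R)
    (fun _ _ _ => 0).
Proof.
split; try (by move=> *; exact: cvg_cst); try (by move=> *; exact: is_derive_cst).
- move=> z; apply: (@continuous_comp _ _ _ fst (fun x : RN => x ord0 i)).
    exact: cvg_fst.
  exact: coord_continuous.
- move=> j x t; have -> : (fun s : R => (x + s *: e_ R j, t).1 ord0 i) =
            cst (x ord0 i) + (j == i)%:R \*: (id : R -> R).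
    apply/funext => s; rewrite /= !mxE /= eq_sym.
    by rewrite [in RHS]/GRing.add /= /GRing.scale /= mulrC.
  apply: is_derive_eq.
  by rewrite add0r /GRing.scale/= mulr1.
Qed.

Definition C21 f : Prop := exists ft fx fxx, C21_data f ft fx fxx.

Lemma C21_compP (p p1 p2 : R -> R) f :
  (forall s, is_derive s (1 : R) p (p1 s)) ->
  (forall s, is_derive s (1 : R) p1 (p2 s)) -> continuous p2 ->
  C21 f -> C21 (p \o f).
Proof.
by move=> dp dp1 cp2 [ft [fx [fxx H]]]; do 3 eexists; apply: C21_comp H; eassumption.
Qed.

Lemma C21_addP f g : C21 f -> C21 g -> C21 (fun z => f z + g z).
Proof.
move=> [? [? [? H]]] [? [? [? H']]]; do 3 eexists; exact: C21_add H H'.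
Qed.

Lemma C21_cstP (c : R) : C21 (fun=> c).
Proof. by do 3 eexists; exact: C21_cst. Qed.

Lemma C21_sumP (I : Type) (r : seq I) (F : I -> RN * R -> R) :
  (forall i, C21 (F i)) -> C21 (fun z => \sum_(i <- r) F i z).
Proof.
move=> CF; elim: r => [|i r IH].
  by under eq_fun do rewrite big_nil; exact: C21_cstP.
by under eq_fun do rewrite big_cons; exact: C21_addP.
Qed.

Lemma C21_affP (a b : R) f : C21 f -> C21 (fun z => a * f z + b).
Proof.
apply: (@C21_compP (fun y => a * y + b) (fun=> a) (fun=> 0)).
- move=> s; apply: (@is_derive_eq _ _ _ ((a \*: (id : R -> R)) + cst b)).
  by rewrite addr0 /GRing.scale/= mulr1.
- by move=> ?; exact: cvg_cst.
Qed.

Lemma is_derive_ppow3 (s : R) : is_derive s (1 : R) (ppow 3) (3 * ppow 2 s).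
Proof. exact: is_derive_ppow. Qed.

Lemma is_derive_ppow2 (s : R) :
  is_derive s (1 : R) (fun s => 3 * ppow 2 s) (6 * ppow 1 s).
Proof.
have := is_derive_ppow 0 s => d; apply: (@is_derive_eq _ _ _ (3 \*: (ppow 2))).
by rewrite /GRing.scale/=; ring.
Qed.

Lemma continuous_6ppow1 : continuous (fun s : R => 6 * ppow 1 s).
Proof.
by move=> s; apply: cvgM; [exact: cvg_cst|exact: continuous_ppow].
Qed.

Lemma C21_ppow3P f : C21 f -> C21 (fun z => ppow 3 (f z)).
Proof.
apply: C21_compP; [exact: is_derive_ppow3|exact: is_derive_ppow2|].
exact: continuous_6ppow1.
Qed.

Lemma C21_sqP f : C21 f -> C21 (fun z => f z ^+ 2).
Proof.
apply: (@C21_compP (fun y => y ^+ 2) (fun y => 2 * y) (fun=> 2)).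
- move=> s; have := @is_deriveX R R id 2 s 1 1 (is_derive_id _ _).
  by rewrite /GRing.scale/= mulr1 expr1.
- move=> s; apply: (@is_derive_eq _ _ _ ((2 \*: (id : R -> R)))).
  by rewrite /GRing.scale/= mulr1.
- by move=> ?; exact: cvg_cst.
Qed.

Lemma C21_data_dt f ft fx fxx : C21_data f ft fx fxx -> dt f = ft.
Proof.
move=> [_ _ _ _ h _ _]; apply/funext => -[x t]; rewrite /dt derive1E /=.
by have [_] := h x t.
Qed.

Lemma C21_data_dx f ft fx fxx : C21_data f ft fx fxx -> forall i, dx i f = fx i.
Proof.
move=> [_ _ _ _ _ h _] i; apply/funext => -[x t]; rewrite /dx derive1E /=.
by have [_] := h i x t.
Qed.

Lemma C21_data_dxx f ft fx fxx : C21_data f ft fx fxx ->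
  forall i j, dx j (dx i f) = fxx i j.
Proof.
move=> h i j; rewrite (C21_data_dx h); case: h => _ _ _ _ _ _ h.
apply/funext => -[x t]; rewrite /dx derive1E /=.
by have [_] := h i j x t.
Qed.

Lemma C21_data_laplacian f ft fx fxx : C21_data f ft fx fxx ->
  laplacian f = (fun z => \sum_i fxx i i z).
Proof.
move=> h; apply/funext => z; apply: eq_bigr => i _.
by rewrite (C21_data_dxx h).
Qed.

(** The derivatives are continuous on the whole space, so they serve as their own extensions to the
    closure of [D]. *)
Lemma C21_C21_closure (D : set (RN * R)) f : C21 f -> C21_closure D f.
Proof.
move=> [ft [fx [fxx h]]]; have [cf ct cx cxx dt_ dx_ dxx] := h.
have c2c (F : RN * R -> R) : continuous F -> cont_to_closure D F.
  by move=> cF; exists F; split => //; exact: continuous_subspaceT.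
split; first exact: continuous_subspaceT.
split.
  move=> [x t] _ /=; split; first by case: (dt_ x t).
  split; first by move=> i; case: (dx_ i x t).
  move=> i j; rewrite (C21_data_dx h); by case: (dxx i j x t).
split; first by rewrite (C21_data_dt h); exact: c2c.
split; first by move=> i; rewrite (C21_data_dx h); exact: c2c.
by move=> i j; rewrite (C21_data_dxx h); exact: c2c.
Qed.

End C21.

(** * Cutoff and test functions *)

Lemma compact_continuous_ler (T : topologicalType) (R : realType) (A : set T)
    (f : T -> R) : compact A -> continuous f ->
  exists2 M, 0 <= M & forall x, A x -> `|f x| <= M.
Proof.
move=> cA cf.
have /compact_bounded[M [Mreal HM]] : compact (f @` A).
  by apply: continuous_compact => //; exact: continuous_subspaceT.
exists (`|M| + 1); first by rewrite addr_ge0.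
move=> x Ax; apply: (HM (`|M| + 1)); last by exists x.
by rewrite (le_lt_trans (ler_norm _))// ltrDl.
Qed.

Section cutoff.
Context {R : realType} {N : nat}.
Local Notation RN := 'rV[R]_N.

(** The cube of 2 (1 - |x - c|^2 / r^2)_+ with the Euclidean norm, constant in time. The factor 2
    lifts the value at the center above 1, the threshold of the covering argument for the cutoff. *)
Definition bump (c : RN) (r : R) (z : RN * R) : R :=
  ppow 3 (- (2 / r ^+ 2) * (\sum_i (z.1 ord0 i - c ord0 i) ^+ 2) + 2).

Lemma C21_bump c r : C21 (bump c r).
Proof.
apply: C21_ppow3P; apply: C21_affP; apply: C21_sumP => i; apply: C21_sqP.
apply: C21_addP; last exact: C21_cstP.
by do 3 eexists; exact: C21_coord.
Qed.

Lemma bump_center c r t : bump c r (c, t) = 8.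
Proof.
rewrite /bump big1 => [|i _]; last by rewrite subrr expr0n.
by rewrite mulr0 add0r ppow_pos// -natrX.
Qed.

Lemma bump_out c r x t : 0 < r -> ~ ball c r x -> bump c r (x, t) = 0.
Proof.
move=> r0 cx; apply: ppow_le0.
(* [ball] is a sup-norm ball: outside it a single coordinate already contributes r^2 to the
   Euclidean sum. *)
have [i xi] : exists i, r <= `|c ord0 i - x ord0 i|.
  apply: contrapT => /forallNP h; apply: cx; split => // a i.
  by rewrite ord1 /ball/= ltNge; apply/negP; exact: h.
have : r ^+ 2 <= \sum_i (x ord0 i - c ord0 i) ^+ 2.
  rewrite (bigD1 i)//= -[leLHS]addr0 lerD//; last first.
    by apply: sumr_ge0 => j _; exact: sqr_ge0.
  by rewrite -(real_normK (num_real (x ord0 i - _))) distrC lerXn2r ?nnegrE// ltW.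
set S := \sum_i _ => rS.
have r2 : 0 < r ^+ 2 by rewrite exprn_gt0.
rewrite mulNr addrC subr_le0 mulrAC ler_pdivlMr//.
by rewrite ler_pM2l.
Qed.

(* 1 - (1 - S)_+^3 caps the sum S of bumps at 1 while remaining C^2. *)
Lemma C21_cutoff (K V : set RN) : compact K -> open V -> K `<=` V ->
  exists phi : RN * R -> R, [/\ C21 phi, forall z, 0 <= phi z <= 1,
    forall x t, K x -> phi (x, t) = 1 & forall x t, ~ V x -> phi (x, t) = 0].
Proof.
move=> cK oV KV.
have /choice[r rP] : forall x, exists r : R, K x -> 0 < r /\ ball x r `<=` V.
  move=> x; have [Kx|nKx] := pselect (K x); last by exists 0.
  have /nbhs_ballP[r r0 rV] : nbhs x V by apply: open_nbhs_nbhs; split => //; exact: KV.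
  by exists r.
have cb x : continuous (bump x (r x)) by have [? [? [? []]]] := C21_bump x (r x).
(* Each point of [K] lies in the open set where its own bump exceeds 1. A finite subcover gives S >
   1 on [K], where (1 - S)_+ vanishes. *)
pose f x := [set y | 1 < bump x (r x) (y, 0)].
have of_ x : open (f x).
  suff cg : continuous (fun y : RN => bump x (r x) (y, 0)).
    by move/continuousP: cg => /(_ [set s | 1 < s]); apply; exact: open_gt.
  move=> y; apply: (@continuous_comp RN (RN * R)%type R (fun y : RN => (y, 0 : R)) (bump x (r x))).
    exact: (cvg_pair (@cvg_id _ (nbhs y)) (cvg_cst (0 : R))).
  exact: cb.
have := cK; rewrite compact_cover => /(_ _ K f) [|x Kx|D DK KD].
- by move=> x _; exact: of_.
- by exists x => //; rewrite /f/= bump_center; lra.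
pose S z := \sum_(x <- D) bump x (r x) z.
have S0 z : 0 <= S z by apply: sumr_ge0 => x _; exact: ppow_ge0.
exists (fun z => -1 * ppow 3 (-1 * S z + 1) + 1); split.
- apply: C21_affP; apply: C21_ppow3P; apply: C21_affP; apply: C21_sumP => x.
  exact: C21_bump.
- move=> z; have : ppow 3 (-1 * S z + 1) <= 1.
    rewrite /ppow exprn_ile1//; first by rewrite le_max lexx orbT.
    by rewrite ge_max ler01 andbT; have := S0 z; lra.
  by have := ppow_ge0 3 (-1 * S z + 1); lra.
- move=> x t Kx; rewrite ppow_le0 ?mulr0 ?add0r//.
  have [c /= cD] := KD x Kx.
  rewrite /f/= => fx; have : bump c (r c) (x, t) <= S (x, t).
    rewrite /S (big_rem c)//= lerDl; apply: sumr_ge0 => ? _; exact: ppow_ge0.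
  rewrite (_ : bump c (r c) (x, t) = bump c (r c) (x, 0))//; lra.
- move=> x t nVx; rewrite /S big_seq big1 ?mulr0 ?add0r.
    by rewrite ppow_pos// expr1n mulr1 addNr.
  move=> c /DK; rewrite inE => /rP[rc rV]; apply: bump_out => //.
  by move=> /rV.
Qed.

End cutoff.

Section test_function.
Context {R : realType} {N : nat}.
Local Notation RN := 'rV[R]_N.

(** With s = (phi - M t)_+, L = phi_t + Laplacian phi and G = |grad phi|^2, the operator d/dt +
    Laplacian maps s^3 to 3 s^2 (L - M) + 6 s G. If L <= A < M and G <= B, the negative quadratic
    term absorbs the linear one up to 3 B^2 / (M - A), which tends to 0 as M grows. *)
Lemma C21_test_function (K V C : set RN) (eps T M0 : R) :
  compact K -> open V -> K `<=` V -> compact C -> V `<=` C ->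
  0 < eps -> 0 < T ->
  exists M (zeta : RN * R -> R), [/\ M0 <= M, 0 < M, C21 zeta,
    forall x, K x -> zeta (x, 0) = 1 & [/\
    forall x t, 0 <= t -> 0 <= zeta (x, t) <= 1,
    forall x t, 0 <= t -> ~ V x \/ M^-1 <= t ->
      zeta (x, t) = 0 /\ dt zeta (x, t) + laplacian zeta (x, t) = 0 &
    forall x t, 0 <= t <= T -> dt zeta (x, t) + laplacian zeta (x, t) <= eps /\
      `|dt zeta (x, t) + laplacian zeta (x, t)| <= 12 * M]].
Proof.
move=> cK oV KV cC VC eps0 T0.
have [phi [[pt [px [pxx Hphi]]] phi01 phiK phiV]] := C21_cutoff cK oV KV.
have cCT : compact (C `*` `[0, T]) by apply: compact_setX => //; exact: segment_compact.
pose L z := pt z + \sum_i pxx i i z.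
pose G z := \sum_i px i z ^+ 2.
have csum (F : 'I_N -> RN * R -> R) :
    (forall i, continuous (F i)) -> continuous (fun z => \sum_i F i z).
  by move=> cF; apply: continuous_big => // z; apply: cvgD; [exact: cvg_fst|exact: cvg_snd].
have cL : continuous L.
  move=> z; apply: cvgD; first exact: (C21_cont_t Hphi).
  by apply: csum => i; exact: (C21_cont_xx Hphi).
have cG : continuous G.
  apply: csum => i z; apply: cvgM; exact: (C21_cont_x Hphi).
have [A A0 LA] := compact_continuous_ler cCT cL.
have [B B0 GB] := compact_continuous_ler cCT cG.
have G0 z : 0 <= G z by apply: sumr_ge0 => i _; exact: sqr_ge0.
(* The bounds [A] and [B] do not involve M. The quotient by [eps] secures 3 B^2 <= eps (M - A); A, B
   < M bound the image of s^3 in absolute value by 3 (A + M) + 6 B <= 12 M. *)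
pose M := A + B + 3 * B ^+ 2 / eps + `|M0| + 1.
have e0 : 0 <= 3 * B ^+ 2 / eps by apply: divr_ge0; [rewrite mulr_ge0// sqr_ge0|exact: ltW].
have M0M : M0 <= M by rewrite /M (le_trans (ler_norm _))//; have := normr_ge0 M0; lra.
have M_gt0 : 0 < M by rewrite /M; have := normr_ge0 M0; lra.
have AM : A < M by rewrite /M; have := normr_ge0 M0; lra.
have BM : B < M by rewrite /M; have := normr_ge0 M0; lra.
have eM : 3 * B ^+ 2 <= eps * (M - A).
  rewrite (mulrC eps) -ler_pdivrMr// /M; set X := _ / eps.
  by have := normr_ge0 M0; lra.
pose w z := phi z + - M * z.2.
have Hlin : C21_data (fun z : RN * R => - M * z.2) (fun=> - M) (fun _ _ => 0)
    (fun _ _ _ => 0).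
  split; try (by move=> *; exact: cvg_cst); try (by move=> *; exact: is_derive_cst).
  - by move=> z; apply: cvgM; [exact: cvg_cst|exact: cvg_snd].
  - move=> x t; have d := @is_deriveZ R R R id (- M) t 1 1 (is_derive_id _ _).
    by refine (is_derive_eq d _); rewrite /GRing.scale/= mulr1.
  - by move=> i x t; exact: (is_derive_cst (- M * t)).
have Hw := C21_add Hphi Hlin.
have Hz := C21_comp (@is_derive_ppow3 R) (@is_derive_ppow2 R) (@continuous_6ppow1 R) Hw.
exists M, (ppow 3 \o w).
have hE z : dt (ppow 3 \o w) z + laplacian (ppow 3 \o w) z =
    3 * ppow 2 (w z) * (L z - M) + 6 * ppow 1 (w z) * G z.
  rewrite (C21_data_dt Hz) (C21_data_laplacian Hz).
  rewrite big_split/= /L /G addrA.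
  under eq_bigr do rewrite !addr0.
  under [X in _ + _ + X = _]eq_bigr do rewrite !addr0.
  rewrite -mulr_sumr.
  under eq_bigr do rewrite -mulrA.
  rewrite -mulr_sumr.
  under eq_bigr do rewrite -expr2.
  rewrite /w; ring.
have w1 x t : 0 <= t -> w (x, t) <= 1.
  move=> t0; have /andP[_ p1] := phi01 (x, t); rewrite /w/=.
  have : 0 <= M * t by rewrite mulr_ge0// ltW.
  by rewrite mulNr; lra.
have w0 x t : 0 <= t -> ~ V x \/ M^-1 <= t -> w (x, t) <= 0.
  move=> t0 [nV|tM]; rewrite /w/= mulNr.
    by rewrite phiV// add0r oppr_le0 mulr_ge0// ltW.
  have /andP[_ p1] := phi01 (x, t); rewrite subr_le0 (le_trans p1)//.
  by rewrite mulrC -ler_pdivrMr// div1r.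
split => //; last split.
- by do 3 eexists; exact: Hz.
- by move=> x Kx; rewrite /w /= phiK// mulr0 addr0 ppow_pos// expr1n.
- move=> x t t0; rewrite /= ppow_ge0/= /ppow exprn_ile1//.
    by rewrite le_max lexx orbT.
  by rewrite ge_max ler01 w1.
- move=> x t t0 h; have w00 := w0 _ _ t0 h.
  by rewrite hE /= !ppow_le0// !mulr0 !mul0r addr0.
- move=> x t /andP[t0 tT]; rewrite hE.
  have [Vx|nVx] := pselect (V x); last first.
    have w00 : w (x, t) <= 0 by apply: w0 => //; left.
    rewrite !ppow_le0//.
    rewrite !mulr0 !mul0r addr0 normr0; split; first exact: ltW.
    by rewrite mulr_ge0// ltW.
  have CT : (C `*` `[0, T]) (x, t) by split; [exact: (VC _ Vx)|rewrite /= in_itv/= t0].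
  have := LA _ CT; have := GB _ CT; have := G0 (x, t).
  rewrite /ppow expr1; set s := Num.max _ _.
  have s0 : 0 <= s by rewrite le_max lexx orbT.
  have s1 : s <= 1 by rewrite ge_max ler01 w1.
  move: (L _) (G _) => l g g0; rewrite (ger0_norm g0) => gB.
  rewrite ler_norml => /andP[lA Al].
  have sg : s * g <= s * B by rewrite ler_wpM2l.
  have s2l : s ^+ 2 * l <= s ^+ 2 * A by rewrite ler_wpM2l// sqr_ge0.
  have s2l' : s ^+ 2 * - A <= s ^+ 2 * l by rewrite ler_wpM2l// sqr_ge0.
  have s2 : s ^+ 2 <= 1 by rewrite exprn_ile1.
  have s20 : 0 <= s ^+ 2 by rewrite sqr_ge0.
  split.
    apply: (@le_trans _ _ (3 * s ^+ 2 * (A - M) + 6 * (s * B))); first lra.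
    (* complete the square: M - A times the difference is
       3 (s (M - A) - B)^2 + (eps (M - A) - 3 B^2) *)
    rewrite -subr_ge0 -(@pmulr_rge0 _ (M - A)) ?subr_gt0//.
    have : 0 <= 3 * (s * (M - A) - B) ^+ 2 by rewrite mulr_ge0// sqr_ge0.
    lra.
  have sMA : s ^+ 2 * (M + A) <= M + A by rewrite ler_piMl//; lra.
  have sMB : s * B <= B by rewrite ler_piMl.
  have sg0 : 0 <= s * g by rewrite mulr_ge0.
  have sM0 : 0 <= s ^+ 2 * M by rewrite mulr_ge0// ltW.
  have sMM : s ^+ 2 * M <= M by rewrite ler_piMl// ltW.
  have sA : s ^+ 2 * A <= A by rewrite ler_piMl.
  by rewrite ler_norml; apply/andP; split; lra.
Qed.

End test_function.

(** * A function growing faster than prescribed linear rates *)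

Section fast_growing.
Context {R : realType}.
Variable c : nat -> R.
Hypothesis c0 : forall n, 0 <= c n.

Let G (m : nat) (s : R) := \sum_(n < m) c n * Num.max (s - n%:R) 0.

Let G_stable (m k : nat) (s : R) : s <= m%:R -> (m <= k)%N -> G k s = G m s.
Proof.
move=> sm /subnKC <-; elim: (k - m)%N => [|d IH]; first by rewrite addn0.
rewrite addnS /G big_ord_recr/= -/(G _ _) IH max_r ?mulr0 ?addr0//.
by rewrite subr_le0 (le_trans sm)// ler_nat leq_addr.
Qed.

Let G_eq (m k : nat) (s : R) : s <= m%:R -> s <= k%:R -> G k s = G m s.
Proof.
move=> sm sk; have [mk|/ltnW km] := leqP m k; first exact: G_stable.
by rewrite -(G_stable sk km).
Qed.

(** The locally finite series of the functions c n (s - n)_+, cut at an integer above |s|, from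
    which on all terms vanish. *)
Definition fast_growing (s : R) := G (Num.bound `|s|) s.

Let le_bound (s : R) : s <= (Num.bound `|s|)%:R.
Proof. by rewrite (le_trans (ler_norm _))// ltW// archi_boundP. Qed.

Let fast_growingE (m : nat) (s : R) : s <= m%:R -> fast_growing s = G m s.
Proof. by move=> sm; apply: G_eq => //; exact: le_bound. Qed.

Lemma continuous_fast_growing : continuous fast_growing.
Proof.
(* Bounding |s + 1| instead of |s| leaves room for a neighbourhood of [s] on which one and the same
   partial sum represents the series. *)
move=> s; set m := Num.bound `|s + 1|.
have cG : continuous (G m).
  apply: continuous_big => [z|i _ t].
    by apply: cvgD; [exact: cvg_fst|exact: cvg_snd].
  apply: cvgM; first exact: cvg_cst.
  apply: (@continuous_max R R (fun t => t - i%:R) (cst 0)); last exact: cvg_cst.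
  by apply: cvgB; [exact: cvg_id|exact: cvg_cst].
have sm : s < m%:R by rewrite (lt_le_trans _ (le_bound _))// ltrDl.
rewrite /continuous_at (fast_growingE (ltW sm)).
apply: cvg_trans (cG s); apply: near_eq_cvg.
near=> t; rewrite (@fast_growingE m)// ltW//; near: t; exact: lt_nbhsl.
Unshelve. all: by end_near. Qed.

Lemma fast_growing_le : {homo fast_growing : x y / x <= y}.
Proof.
move=> x y xy; have ym := le_bound y.
rewrite (fast_growingE ym) (fast_growingE (le_trans xy ym)).
apply: ler_sum => i _; rewrite ler_wpM2l//.
by rewrite ge_max !le_max lexx orbT andbT lerB.
Qed.

Lemma fast_growing_le0 (s : R) : s <= 0 -> fast_growing s = 0.
Proof. by move=> s0; rewrite (@fast_growingE 0%N)// /G big_ord0. Qed.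

Lemma fast_growing_ge (n : nat) (s : R) :
  n.+1%:R <= s -> c n * (s - n%:R) <= fast_growing s.
Proof.
move=> ns; rewrite /fast_growing /G.
have nb : (n < Num.bound `|s|)%N.
  by rewrite -(ltr_nat R) (lt_le_trans _ (le_bound s))// (lt_le_trans _ ns)// ltr_nat.
rewrite (bigD1 (Ordinal nb))//= -[leLHS]addr0 lerD//.
  by rewrite ler_wpM2l// le_max lexx.
by apply: sumr_ge0 => i _; rewrite mulr_ge0// le_max lexx orbT.
Qed.

End fast_growing.

Lemma exists_fast_growing (R : realType) (H : nat -> R) : (forall n, 0 <= H n) ->
  exists g : R -> R, [/\ continuous g, {homo g : x y / x <= y},
    forall s, s <= 0 -> g s = 0 &
    forall n s, n.+1%:R <= s -> H n * s <= g s].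
Proof.
(* The factor n + 1 turns the slope at n into a bound through the origin: (n + 1) (s - n) - s = n (s
   - n - 1) >= 0 for s >= n + 1. *)
move=> H0; pose c n := n.+1%:R * H n.
have c0 n : 0 <= c n by rewrite mulr_ge0.
exists (fast_growing c); split.
- exact: continuous_fast_growing.
- exact: fast_growing_le.
- exact: fast_growing_le0.
- move=> n s ns; apply: le_trans (fast_growing_ge c0 ns).
  rewrite /c (mulrC n.+1%:R) -mulrA ler_wpM2l//.
  rewrite -natr1; have : 0 <= n%:R * (s - n.+1%:R) :> R by rewrite mulr_ge0// subr_ge0.
  by rewrite -natr1; lra.
Qed.

(** * Borel sets of R^N *)

Section borel.
Context {R : realType} {N : nat}.
Local Notation RN := 'rV[R]_N.
Implicit Types A K U V : set RN.

Lemma open_measurable_rV U : open U -> measurable U.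
Proof. exact: sub_sigma_algebra. Qed.

Lemma closed_measurable_rV A : closed A -> measurable A.
Proof.
move=> cA; rewrite -(setCK A); apply: measurableC; apply: open_measurable_rV.
exact: closed_openC.
Qed.

Lemma compact_closed_rV K : compact K -> closed K.
Proof. by apply: compact_closed; exact: norm_hausdorff. Qed.

Lemma compact_measurable_rV K : compact K -> measurable K.
Proof. by move=> /compact_closed_rV; exact: closed_measurable_rV. Qed.

(** For a bounded open [U] and r = 1/(n+1) these sets are an increasing exhaustion of [U] by compact
    sets, on which a Radon measure on [U] is finite. *)
Definition erosion (r : R) (U : set RN) : set RN := [set x | ball x r `<=` U].

Lemma erosion_closed r U : closed (erosion r U).
Proof.
have -> : erosion r U = ~` \bigcup_(y in ~` U) ball y r.
  apply/seteqP; split=> x /=.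
    by move=> xU [y nU yx]; apply: nU; apply: xU; exact: ball_sym.
  move=> h y xy; apply: contrapT => nU; apply: h; exists y => //.
  exact: ball_sym.
by apply: open_closedC; apply: bigcup_open => y _; exact: ball_open.
Qed.

Lemma erosion_sub r U : 0 < r -> erosion r U `<=` U.
Proof. by move=> r0 x; apply; exact: ballxx. Qed.

Lemma erosion_bigcup U : open U -> \bigcup_n erosion n.+1%:R^-1 U = U.
Proof.
move=> oU; apply/seteqP; split=> [x [n _]|x Ux]; first by apply: erosion_sub.
have /nbhs_ballP[r /= r0 rU] : nbhs x U by apply: open_nbhs_nbhs.
have [n nr] : exists n : nat, n.+1%:R^-1 < r.
  exists (Num.bound r^-1); rewrite invf_plt ?posrE// (lt_trans (archi_boundP _))//.
    by rewrite invr_ge0 ltW.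
  by rewrite ltr_nat.
by exists n => //; apply: subset_trans rU; apply: le_ball; exact: ltW.
Qed.

Lemma erosion_nd U : {homo (fun n => erosion n.+1%:R^-1 U) : m n / (m <= n)%N >-> m `<=` n}.
Proof.
move=> m n mn x; apply: subset_trans; apply: le_ball.
by rewrite lef_pV2 ?posrE// ler_nat.
Qed.

(** Continuity from above; the strict inequality for the limit set makes it survive at a finite
    stage. *)
Lemma near_lt_measure (nu : {measure set RN -> \bar R}) (F : (set RN)^nat) (e : R) :
  (nu (F 0%N) < +oo)%E ->
  (forall n, measurable (F n)) -> {homo F : m n / (m <= n)%N >-> n `<=` m} ->
  (nu (\bigcap_n F n) < e%:E)%E -> exists n, (nu (F n) <= e%:E)%E.
Proof.
move=> F0 mF niF Fe.
have : nu \o F @ \oo --> nu (\bigcap_n F n).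
  apply: nonincreasing_cvg_mu => //.
  - exact: bigcapT_measurable.
  - by move=> m n mn; apply/subsetPset; exact: niF.
move=> /(_ [set y | y < e%:E]%E) [|n _ /(_ n (leqnn _)) /ltW]; last by exists n.
by apply: open_nbhs_nbhs; split => //; exact: open_ereal_lt_ereal.
Qed.

(** Inner regularity is phrased through the measure of the difference, so that errors add up under
    countable operations by subadditivity. *)
Definition closed_inner (nu : set RN -> \bar R) A := forall e : R, 0 < e ->
  exists F, [/\ closed F, F `<=` A & (nu (A `\` F) <= e%:E)%E].

Lemma closed_inner_open (nu : {finite_measure set RN -> \bar R}) U :
  open U -> closed_inner nu U.
Proof.
move=> oU e e0; pose F n := U `\` erosion n.+1%:R^-1 U.
have [||m n mn||n nu_n] := @near_lt_measure nu F e.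
- rewrite ltey_eq fin_num_measure//; apply: measurableD; first exact: open_measurable_rV.
  by apply: closed_measurable_rV; exact: erosion_closed.
- move=> n; apply: measurableD; first exact: open_measurable_rV.
  by apply: closed_measurable_rV; exact: erosion_closed.
- by apply: setDS; exact: (erosion_nd mn).
- rewrite bigcupDr; last by exists 0%N.
  by rewrite erosion_bigcup// setDv measure0 lte_fin.
- exists (erosion n.+1%:R^-1 U); split => //; first exact: erosion_closed.
  exact: erosion_sub.
Qed.

Lemma closed_inner_seq (nu : {measure set RN -> \bar R}) (A : (set RN)^nat) (e : R) :
  (forall n, measurable (A n)) -> (forall n, closed_inner nu (A n)) -> 0 < e ->
  exists F : (set RN)^nat, [/\ forall n, closed (F n), forall n, F n `<=` A n &
    (nu (\bigcup_n (A n `\` F n)) <= e%:E)%E].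
Proof.
move=> mA iA e0.
have /choice[F FP] : forall n, exists F, [/\ closed F, F `<=` A n &
    (nu (A n `\` F) <= (e / (2 ^ n.+1)%:R)%:E)%E].
  by move=> n; apply: iA; rewrite divr_gt0// ltr0n expn_gt0.
exists F; split; [by move=> n; case: (FP n)..|].
have mAF n : measurable (A n `\` F n).
  by apply: measurableD => //; apply: closed_measurable_rV; case: (FP n).
apply: (le_trans (measure_sigma_subadditive _ _ _ (@subset_refl _ _))) => //.
  exact: bigcupT_measurable.
apply: le_trans (epsilon_trick0 predT (ltW e0)).
by apply: lee_nneseries => // n _; case: (FP n).
Qed.

Lemma closed_inner_bigcap (nu : {measure set RN -> \bar R}) (A : (set RN)^nat) :
  (forall n, measurable (A n)) -> (forall n, closed_inner nu (A n)) ->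
  closed_inner nu (\bigcap_n A n).
Proof.
move=> mA iA e e0; have [F [cF FA nuF]] := closed_inner_seq mA iA e0.
have mAF n : measurable (A n `\` F n).
  by apply: measurableD => //; exact: closed_measurable_rV.
exists (\bigcap_n F n); split; first exact: closed_bigI.
  by move=> x xF n _; apply: FA; exact: xF.
apply: le_trans nuF; apply: le_measure; rewrite ?inE.
- apply: measurableD; first exact: bigcapT_measurable.
  by apply: bigcapT_measurable => n; exact: closed_measurable_rV.
- exact: bigcupT_measurable.
- move=> x [xA nF]; apply: contrapT => h; apply: nF => n _.
  apply: contrapT => nFn; apply: h; exists n => //; split => //; exact: xA.
Qed.

(** The union of the closed approximations need not be closed, but its finite parts are. Finiteness
    of [nu] allows continuity from above to pass to one of them. *)
Lemma closed_inner_bigcup (nu : {finite_measure set RN -> \bar R}) (A : (set RN)^nat) :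
  (forall n, measurable (A n)) -> (forall n, closed_inner nu (A n)) ->
  closed_inner nu (\bigcup_n A n).
Proof.
(* Spending only e/2 keeps the limit set strictly below [e], as [near_lt_measure] requires. *)
move=> mA iA e e0; have e20 : 0 < e / 2 by rewrite divr_gt0.
have [F [cF FA nuF]] := closed_inner_seq mA iA e20.
have mAF n : measurable (A n `\` F n).
  by apply: measurableD => //; exact: closed_measurable_rV.
have mF n : measurable (F n) by exact: closed_measurable_rV.
pose G n := \big[setU/set0]_(i < n) F i.
have cG n : closed (G n) by apply: closed_bigsetU.
have [||m n mn||n nu_n] := @near_lt_measure nu (fun n => \bigcup_k A k `\` G n) e.
- rewrite ltey_eq fin_num_measure//; apply: measurableD; first exact: bigcupT_measurable.
  exact: closed_measurable_rV.
- move=> n; apply: measurableD; first exact: bigcupT_measurable.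
  exact: closed_measurable_rV.
- apply: setDS; rewrite /G -!bigcup_mkord => x [k /= km Fk].
  by exists k => //=; exact: leq_trans mn.
- rewrite bigcupDr; last by exists 0%N.
  apply: (@le_lt_trans _ _ (e / 2)%:E); last first.
    by rewrite lte_fin; lra.
  apply: le_trans nuF; apply: le_measure; rewrite ?inE.
  + apply: measurableD; first exact: bigcupT_measurable.
    by apply: bigcupT_measurable => n; exact: closed_measurable_rV.
  + exact: bigcupT_measurable.
  + move=> x [[n _ An] h]; exists n => //; split => // Fn; apply: h.
    by exists n.+1 => //; rewrite /G big_ord_recr; right.
- exists (G n); split => // x; rewrite /G -bigcup_mkord => -[k /= _ /FA Ak].
  by exists k.
Qed.

(** The sets that are approximable together with their complements form a sigma-algebra: complements
    are built in, unions of sets and intersections of complements are covered by the two preceding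
    lemmas. It contains the open sets. *)
Lemma closed_inner_regular (nu : {finite_measure set RN -> \bar R}) A :
  measurable A -> closed_inner nu A.
Proof.
pose C := [set A : set RN | measurable A /\ closed_inner nu A /\ closed_inner nu (~` A)].
suff : measurable `<=` C by move=> mC /mC[_ []].
have closed_innerC (F : set RN) : closed F -> closed_inner nu F.
  by move=> cF e e0; exists F; split => //; rewrite setDv measure0 lee_fin ltW.
apply: smallest_sub => [|U oU].
  split.
  - split; first exact: measurable0.
    by split; [apply: closed_innerC; exact: closed0|
      rewrite setC0; apply: closed_innerC; exact: closedT].
  - move=> B [mB [iB iCB]]; rewrite setTD.
    by split; [exact: measurableC|rewrite setCK].
  - move=> B CB; split; first by apply: bigcupT_measurable => n; case: (CB n).
    split; first by apply: closed_inner_bigcup => n; case: (CB n) => // _ [].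
    rewrite setC_bigcup; apply: closed_inner_bigcap => n.
      by apply: measurableC; case: (CB n).
    by case: (CB n) => // _ [].
split; first exact: open_measurable_rV.
split; first exact: closed_inner_open.
by apply: closed_innerC; exact: open_closedC.
Qed.

End borel.

(** * Lebesgue measure of balls, distance to the boundary, neighbourhoods of compact sets *)

Section geometry.
Context {R : realType} {N : nat}.
Local Notation RN := 'rV[R]_N.
Implicit Types (A K U : set RN) (lam : {measure set RN -> \bar R}).

Lemma continuous_measurable_rV (f : RN -> R) : continuous f -> measurable_fun setT f.
Proof.
move=> /continuousP cf; apply: (measurability _ (RGenOpens.measurableE R)).
move=> _ [_ [a [b ->] <-]]; rewrite setTI; apply: open_measurable_rV.
exact/cf/interval_open.
Qed.

Lemma measurable_box (a b : RN) :
  measurable [set x : RN | forall i, a ord0 i <= x ord0 i < b ord0 i].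
Proof.
have -> : [set x : RN | forall i, a ord0 i <= x ord0 i < b ord0 i] =
    \bigcap_(i in [set: 'I_N]) ((fun x : RN => x ord0 i) @^-1` `[a ord0 i, b ord0 i[).
  apply/seteqP; split=> x /= h i; first by move=> _; rewrite /= in_itv/=.
  by have := h i I; rewrite /= in_itv/=.
apply: fin_bigcap_measurable => // i _; rewrite -[X in measurable X]setTI.
by apply: continuous_measurable_rV => //; exact: coord_continuous.
Qed.

Lemma is_lebesgue_ball lam (r : R) : is_lebesgue_RN lam -> (lam (ball (0%R : RN) r) < +oo)%E.
Proof.
move=> Hlam; have [r0|r0] := ltP 0 r; last first.
  rewrite (_ : ball (0%R : RN) r = set0) ?measure0//; apply/seteqP; split=> // x [].
  by rewrite ltNge r0.
have := Hlam (const_mx (- r)) (const_mx r).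
set B := [set _ | _] => HB.
have : (lam B < +oo)%E by rewrite HB ?ltry// => i; rewrite !mxE; lra.
apply: le_lt_trans; apply: le_measure; rewrite ?inE.
- by apply: open_measurable_rV; exact: ball_open.
- exact: measurable_box.
- move=> x [_ xr] i; have := xr ord0 i; rewrite /ball/= !mxE sub0r normrN.
  by rewrite ltr_norml => /andP[/ltW -> ->].
Qed.

Lemma bigcup_ball0 : \bigcup_n ball (0%R : RN) n%:R = setT.
Proof.
apply/seteqP; split=> // x _; exists (Num.bound `|x|) => //.
by rewrite -ball_normE /ball_/= sub0r normrN archi_boundP.
Qed.

Lemma is_lebesgue_sigma_finite lam : is_lebesgue_RN lam -> sigma_finite setT lam.
Proof.
move=> Hlam; exists (fun n => ball (0%R : RN) n%:R); first by rewrite bigcup_ball0.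
move=> n; split; first by apply: open_measurable_rV; exact: ball_open.
exact: is_lebesgue_ball.
Qed.

Lemma bounded_sub_ball A : bounded_set A -> exists2 r, 0 < r & A `<=` ball (0%R : RN) r.
Proof.
move=> [M [_ HM]]; exists (`|M| + 2); first by rewrite ltr_wpDl.
move=> x Ax; rewrite -ball_normE /ball_/= sub0r normrN.
apply: (@le_lt_trans _ _ (`|M| + 1)); last by lra.
by apply: (HM (`|M| + 1)) => //; rewrite (le_lt_trans (ler_norm _))// ltrDl.
Qed.

Lemma continuous_enorm_sub (y : RN) : continuous (fun x : RN => enorm (x - y)).
Proof.
move=> x; apply: (@continuous_comp RN R R (fun x => \sum_i (x - y) ord0 i ^+ 2)
  Num.sqrt); last exact: sqrt_continuous.
apply: continuous_big => [z|i _ z].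
  by apply: cvgD; [exact: cvg_fst|exact: cvg_snd].
apply: (@continuous_comp RN R R (fun x => (x - y) ord0 i) (fun s => s ^+ 2)).
  apply: (@continuous_comp RN RN R (fun x => x - y) (fun x => x ord0 i)).
    exact: (@cvgB _ RN _ (nbhs z) _ id (cst y) z y cvg_id (cvg_cst y)).
  exact: coord_continuous.
exact: exprn_continuous.
Qed.

Lemma coord_le_enorm (x : RN) i : `|x ord0 i| <= enorm x.
Proof.
rewrite -sqrtr_sqr ler_wsqrtr// (bigD1 i)//= lerDl.
by apply: sumr_ge0 => j _; exact: sqr_ge0.
Qed.

Lemma enorm_ge0 (x : RN) : 0 <= enorm x.
Proof. exact: sqrtr_ge0. Qed.

Lemma rho_ge0 U (x : RN) : 0 <= rho U x.
Proof.
rewrite /rho; have [[y Uy]|/set0P/negP/negPn/eqP->] := pselect (boundary U !=set0).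
  apply: lb_le_inf; first by exists (enorm (x - y)), y.
  by move=> _ [z _ <-]; exact: enorm_ge0.
by rewrite image_set0 inf0.
Qed.

(** As an infimum of continuous functions, [rho] has superlevel sets {rho >= c} that are complements
    of unions of open sets. If the boundary is empty, [inf] takes its default value 0. *)
Lemma measurable_rho U : measurable_fun setT (rho U).
Proof.
have [[y0 Uy0]|/set0P/negP/negPn/eqP U0] := pselect (boundary U !=set0); last first.
  rewrite (_ : rho U = cst 0); first exact: measurable_cst.
  by apply/funext => x; rewrite /rho U0 image_set0 inf0.
apply: (measurability _ (RGenCInfty.measurableE R)) => _ [_ [c ->] <-].
rewrite setTI (_ : _ @^-1` _ =
    ~` \bigcup_(y in boundary U) [set x : RN | enorm (x - y) < c]).
  apply: measurableC; apply: open_measurable_rV; apply: bigcup_open => y _.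
  have /continuousP := continuous_enorm_sub (y := y).
  by move/(_ [set s | s < c]); apply; exact: open_lt.
apply/seteqP; split=> x /=; rewrite in_itv/= andbT.
  move=> cx [y Uy /=]; rewrite ltNge => /negP; apply; apply: le_trans cx _.
  by apply: ge_inf; [exists 0 => _ [z _ <-]; exact: enorm_ge0|exists y].
move=> h; apply: lb_le_inf; first by exists (enorm (x - y0)), y0.
move=> _ [z Uz <-]; rewrite leNgt; apply/negP => zc; apply: h.
by exists z.
Qed.

(** Boundary points of an open set lie outside it, hence outside the sup-norm ball, and the
    Euclidean norm dominates the sup norm. A nonempty boundary excludes the default value 0 of
    [inf]. *)
Lemma rho_ge_ball U x (r : R) : open U -> boundary U !=set0 ->
  0 < r -> ball x r `<=` U -> r <= rho U x.
Proof.
move=> oU [y0 Uy0] r0 xU; apply: lb_le_inf; first by exists (enorm (x - y0)), y0.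
move=> _ [y [_ nUy] <-]; rewrite leNgt; apply/negP => yr; apply: nUy; apply: xU.
split=> // a i; rewrite ord1 /ball/=; apply: le_lt_trans yr.
by have := coord_le_enorm (x - y) i; rewrite !mxE.
Qed.

(** Otherwise [U] would be clopen. Its trace on the line x + s (1, ..., 1) would be nonempty and
    clopen in the connected real line, hence everything, against boundedness. *)
Lemma boundary_neq0 U : (1 <= N)%N -> U !=set0 -> open U -> bounded_set U ->
  boundary U !=set0.
Proof.
move=> N1 [x Ux] oU bU; apply: contrapT => b0.
have cU : closed U.
  by move=> y cy; apply: contrapT => nUy; apply: b0; exists y.
pose l (s : R) : RN := x + const_mx s.
have cl : continuous l.
  move=> s; apply: cvgD; first exact: cvg_cst.
  apply/cvg_ballP => e e0; near=> t; split=> // i j; rewrite !mxE.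
  near: t; exact: (nbhsx_ballx s e e0).
have lT : l @^-1` U = setT.
  have cT : connected [set: R] by apply/connected_intervalP => a b _ _ c _.
  apply: cT.
  - by exists 0; rewrite /l/= (_ : const_mx 0 = 0) ?addr0//; apply/matrixP => i j; rewrite !mxE.
  - by exists (l @^-1` U); [move/continuousP: cl; exact|rewrite setTI].
  - by exists (l @^-1` U); [move/continuous_closedP: cl; exact|rewrite setTI].
have [r r0 Ur] := bounded_sub_ball bU.
pose i0 : 'I_N := Ordinal N1.
(* At this parameter the chosen coordinate equals [r], which puts the point outside the ball of
   radius [r] containing [U]. *)
have : U (l (r - x ord0 i0)) by rewrite -[U _]/((l @^-1` U) _) lT.
move=> /Ur[_ /(_ ord0 i0)]; rewrite /ball/= !mxE sub0r normrN.
by rewrite addrCA subrr addr0 gtr0_norm// ltxx.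
Unshelve. all: by end_near. Qed.

Lemma compact_erosion U (r : R) : bounded_set U -> 0 < r -> compact (erosion r U).
Proof.
move=> bU r0; apply: bounded_closed_compact; last exact: erosion_closed.
have [M [Mr HM]] := bU; exists M; split=> // x Mx y /(erosion_sub r0).
exact: HM.
Qed.

Definition thicken (r : R) (K : set RN) : set RN := \bigcup_(x in K) ball x r.

Lemma thicken_open r K : open (thicken r K).
Proof. by apply: bigcup_open => x _; exact: ball_open. Qed.

Lemma sub_thicken r K : 0 < r -> K `<=` thicken r K.
Proof. by move=> r0 x Kx; exists x => //; exact: ballxx. Qed.

Lemma thicken_nd K : {homo (fun n => thicken n.+1%:R^-1 K) : m n / (m <= n)%N >-> n `<=` m}.
Proof.
move=> m n mn y [x Kx xy]; exists x => //; apply: le_ball xy.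
by rewrite lef_pV2 ?posrE// ler_nat.
Qed.

Lemma thicken_bigcap K : closed K -> \bigcap_n thicken n.+1%:R^-1 K = K.
Proof.
move=> cK; apply/seteqP; split=> [y h|x Kx n _]; last exact: sub_thicken.
apply: contrapT => nKy.
have : (~` K) y by [].
rewrite -(erosion_bigcup (closed_openC cK)) => -[n _ yn].
have [x Kx xy] := h n I; have := yn x (ball_sym xy); exact.
Qed.

(** A Lebesgue number argument. It supplies a compact subset of [U] that still contains a
    neighbourhood of [K], so that all cutoffs can share one compact set. *)
Lemma compact_thicken_sub K U : compact K -> open U -> K `<=` U ->
  exists n : nat, thicken n.+1%:R^-1 K `<=` erosion n.+1%:R^-1 U.
Proof.
move=> cK oU KU.
(* The factor 3 pays for three steps of length at most 1/(n+1): from the eroded point to [K], within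
   the thickening of [K], and within the final ball. *)
pose f (n : nat) := thicken n.+1%:R^-1 (erosion (3 * n.+1%:R^-1) U).
have := cK; rewrite compact_cover => /(_ _ setT f) [n _|x Kx|D _ KD].
- exact: thicken_open.
- have /nbhs_ballP[r /= r0 rU] : nbhs x U by apply: open_nbhs_nbhs; split => //; exact: KU.
  have [n nr] : exists n : nat, 3 * n.+1%:R^-1 < r.
    exists (Num.bound (3 / r)); rewrite -ltr_pdivlMl// invf_plt ?posrE// ?mulr_gt0 ?invr_gt0//.
    rewrite invfM invrK (lt_trans (archi_boundP _)) ?divr_ge0 ?ltW//.
    by rewrite ltr_nat.
  exists n => //; apply: sub_thicken => //.
  by apply: subset_trans rU; apply: le_ball; exact: ltW.
pose m := \max_(n <- D) n.
exists m => y [k Kk ky] z yz.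
have [n /= nD [x xU xk]] := KD k Kk.
have nm : (n <= m)%N by rewrite /m (big_rem n)//= leq_maxl.
have mn : m.+1%:R^-1 <= n.+1%:R^-1 :> R by rewrite lef_pV2 ?posrE// ler_nat.
apply: xU; have -> : 3 * n.+1%:R^-1 = n.+1%:R^-1 + n.+1%:R^-1 + n.+1%:R^-1 :> R.
  by move: (n.+1%:R^-1 : R) => a; ring.
apply: ball_triangle (le_ball mn yz).
exact: ball_triangle xk (le_ball mn ky).
Qed.

End geometry.

(** * Integral estimates *)

Section integral_bounds.
Local Open Scope ereal_scope.
Context d (T : measurableType d) (R : realType) (mu : {measure set T -> \bar R}).
Implicit Types (D E : set T).

(* Unlike in the library, [f] need not be measurable: this spares a
   measurability proof for the integrands of the weak formulation. *)
Lemma ge0_le_integral_nonmeasurable D (f g : T -> \bar R) :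
  (forall x, D x -> 0 <= f x) -> (forall x, D x -> f x <= g x) ->
  \int[mu]_(x in D) f x <= \int[mu]_(x in D) g x.
Proof.
move=> f0 fg; have g0 x : D x -> 0 <= g x by move=> Dx; apply: le_trans (fg _ Dx); exact: f0.
rewrite !ge0_integralE//; apply: ereal_sup_le => _ [h hf <-]; exists h => //= x.
apply: le_trans (hf x) _; rewrite /patch; case: ifPn => // /set_mem; exact: fg.
Qed.

Lemma integral_bound D E (u G I : T -> R) (a c : R) :
  measurable D -> measurable E -> E `<=` D ->
  mu.-integrable D (EFin \o u) ->
  measurable_fun setT G -> (forall x, 0 <= G x)%R -> (0 <= a)%R -> (0 <= c)%R ->
  (forall x, D x -> (I x <= a * `|u x| + c * \1_E x + 2 * (G x * \1_E x))%R) ->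
  \int[mu]_(x in D) (I x)%:E <=
    a%:E * \int[mu]_(x in D) `|(u x)%:E| + c%:E * mu E + 2%:E * \int[mu]_(x in E) (G x)%:E.
Proof.
move=> mD mE ED iu mG G0 a0 c0 Ile.
have mu_ : measurable_fun D u by apply/measurable_EFinP; exact: measurable_int iu.
have i0 (x : T) : (0 <= \1_E x :> R)%R by rewrite indicE.
pose F1 x := (a * `|u x|)%:E.
pose F2 x := (c * \1_E x)%:E.
pose F3 x := (2 * (G x * \1_E x))%:E.
have mF1 : measurable_fun D F1.
  by apply/measurable_EFinP; apply: measurable_funM => //; exact: measurableT_comp.
have mI : measurable_fun D (\1_E : T -> R) by exact: measurable_funTS.
have mF2 : measurable_fun D F2 by apply/measurable_EFinP; exact: measurable_funM.
have mF3 : measurable_fun D F3.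
  apply/measurable_EFinP; apply: measurable_funM => //; apply: measurable_funM => //.
  exact: measurable_funTS.
apply: (@le_trans _ _ (\int[mu]_(x in D) (F1 x + F2 x + F3 x))).
  (* [I] is not assumed measurable: the negative part is dropped, and the positive part is compared
     with the nonnegative measurable majorant. *)
  rewrite integralE; apply: (@le_trans _ _ (\int[mu]_(x in D) (EFin \o I)^\+ x)).
    rewrite -[leRHS]sube0; apply: leeB => //.
    by apply: integral_ge0 => x _; exact: funeneg_ge0.
  apply: ge0_le_integral_nonmeasurable => x Dx; first exact: funepos_ge0.
  rewrite funeposE /= /maxe; case: ifP => _.
    by rewrite -!EFinD lee_fin !addr_ge0 ?mulr_ge0.
  by rewrite -!EFinD lee_fin; exact: Ile.
rewrite ge0_integralD//; last 3 first.
- by move=> x _; rewrite -EFinD lee_fin !addr_ge0 ?mulr_ge0.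
- exact: emeasurable_funD.
- by move=> x _; rewrite lee_fin !mulr_ge0.
rewrite ge0_integralD//; last 2 first.
- by move=> x _; rewrite lee_fin !mulr_ge0.
- by move=> x _; rewrite lee_fin !mulr_ge0.
apply: leeD; first apply: leeD.
- rewrite /F1; under eq_integral do rewrite EFinM.
  rewrite ge0_integralZl_EFin//.
  by apply/measurable_EFinP; exact: measurableT_comp.
- rewrite /F2; under eq_integral do rewrite EFinM.
  rewrite ge0_integralZl_EFin//; last first.
    by apply/measurable_EFinP.
  by rewrite integral_indic// setIidl.
- rewrite /F3; under eq_integral do rewrite EFinM.
  rewrite ge0_integralZl_EFin//; last 2 first.
    by move=> x _; rewrite lee_fin mulr_ge0.
    by apply/measurable_EFinP; apply: measurable_funM => //; exact: measurable_funTS.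
  rewrite lee_pmul2l// -[in leRHS](setIidr ED) integral_mkcondr.
  rewrite le_eqVlt; apply/orP; left; apply/eqP; apply: eq_integral => x _.
  by rewrite patchE indicE; case: ifP => _; rewrite ?mulr1 ?mulr0.
Qed.

Lemma integral_small_measure (G : T -> R) : mu.-integrable setT (EFin \o G) ->
  (forall x, 0 <= G x)%R -> forall e : R, (0 < e)%R ->
  exists2 r : R, (0 < r)%R & forall A, measurable A -> mu A < r%:E ->
    \int[mu]_(x in A) (G x)%:E <= e%:E.
Proof.
move=> iG G0 e e0; have [r [r0 re]] := integral_normr_continuous iG e0.
exists r => // A mA Ar.
have iA : mu.-integrable A (EFin \o G) by exact: integrableS iG.
have := re A mA Ar; rewrite /Rintegral -lte_fin fineK; last first.
  under eq_integral do rewrite ger0_norm//.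
  exact: integrable_fin_num iA.
by move=> /ltW; under eq_integral do rewrite ger0_norm//.
Qed.

(** On [D] the weight is at least [r], hence |h| <= |h| w / r there. *)
Lemma integrable_patch_weight Q D (h w : T -> R) (r : R) :
  measurable Q -> measurable D -> D `<=` Q -> (0 < r)%R ->
  measurable_fun Q h -> measurable_fun setT w -> (forall x, 0 <= w x)%R ->
  (forall x, D x -> r <= w x)%R ->
  \int[mu]_(x in Q) (`|h x| * w x)%:E < +oo ->
  mu.-integrable setT (EFin \o (h \_ D)).
Proof.
move=> mQ mD DQ r0 mh mw w0 rw ih.
have mhD : measurable_fun D h by exact: measurable_funS mh.
rewrite -restrict_EFin; apply/(integrable_mkcond (EFin \o h) mD).
apply/integrableP; split; first exact/measurable_EFinP.
have mhw : measurable_fun Q (fun z => `|h z| * w z)%R.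
  by apply: measurable_funM; [exact: measurableT_comp|exact: measurable_funTS].
have hw0 x : (0 <= `|h x| * w x)%R by rewrite mulr_ge0.
apply: (@le_lt_trans _ _ (r^-1%:E * \int[mu]_(x in Q) (`|h x| * w x)%:E)); last first.
  by rewrite lte_mul_pinfty// lee_fin invr_ge0 ltW.
rewrite -ge0_integralZl_EFin//; last 3 first.
- by move=> x _; rewrite lee_fin.
- exact/measurable_EFinP.
- by rewrite invr_ge0 ltW.
apply: (@le_trans _ _ (\int[mu]_(x in D) (r^-1%:E * (`|h x| * w x)%:E))).
  apply: ge0_le_integral_nonmeasurable => [x _|x Dx]; first exact: abse_ge0.
  by rewrite /= lee_fin ler_pdivlMl// mulrC ler_wpM2l// rw.
apply: ge0_subset_integral => //.
- by apply/measurable_EFinP; apply: measurable_funM.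
- by move=> x _; rewrite lee_fin mulr_ge0// invr_ge0 ltW.
Qed.

Lemma mu_le_integral D K (z : T -> R) : measurable D -> measurable K -> K `<=` D ->
  (forall x, D x -> 0 <= z x)%R -> (forall x, K x -> z x = 1)%R ->
  mu K <= \int[mu]_(x in D) (z x)%:E.
Proof.
move=> mD mK KD z0 z1; rewrite -[in leLHS](setIidl KD) -integral_indic//.
apply: ge0_le_integral_nonmeasurable => x Dx; rewrite lee_fin indicE.
  by [].
by case: (boolP (x \in K)) => [/set_mem/z1->//|_]; exact: z0.
Qed.

End integral_bounds.

(** * Compact null sets are not charged *)

Section null_compact.
Context {R : realType} {N : nat}.
Local Notation RN := 'rV[R]_N.
Context (Om : set RN) (T : R) (lam : {measure set RN -> \bar R}).
Hypotheses (oOm : open Om) (bOm : bounded_set Om) (Om0 : boundary Om !=set0)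
  (T0 : 0 < T) (Hlam : is_lebesgue_RN lam).

Let m : {measure set (RN * measurableTypeR R) -> \bar R} := (lam \x (@lebesgue_measure R))%E.

Let measurable_QT : measurable (QT Om T).
Proof. by apply: measurableX; [exact: open_measurable_rV|exact: measurable_itv]. Qed.

(** The test functions live over a fixed erosion of [Om], where [rho] is bounded below. There the
    weighted integrability of g(u) becomes plain integrability, to which absolute continuity of the
    integral applies. *)
Lemma L1rho_integrable (r : R) (h : RN * R -> R) : 0 < r -> L1rho Om lam (QT Om T) h ->
  m.-integrable setT (EFin \o (h \_ (erosion r Om `*` `]0, T[))).
Proof.
move=> r0 [mh ih]; pose D := erosion r Om `*` `]0, T[%classic.
have mD : measurable D.
  apply: measurableX; last exact: measurable_itv.
  by apply: closed_measurable_rV; exact: erosion_closed.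
have DQ : D `<=` QT Om T.
  by move=> z [z1 z2]; split => //; apply: erosion_sub z1.
have mrho : measurable_fun [set: RN * measurableTypeR R] (fun z => rho Om z.1).
  by apply: measurableT_comp => //; exact: measurable_rho.
apply: (@integrable_patch_weight _ _ R m (QT Om T) D h (fun z => rho Om z.1) r
    measurable_QT mD DQ r0 mh mrho).
- by move=> z; exact: rho_ge0.
- by move=> z [z1 _]; exact: rho_ge_ball.
- exact: ih.
Qed.

(** The square in the bound on [lam V] leaves 12/(n+1) in the key estimate: the factor 12 M (n+1)
    meets a set of measure at most (n+1)^-2 / M. *)
Lemma exists_test_sequence (K C : set RN) :
  compact K -> lam K = 0%E -> compact C -> C `<=` Om ->
  (exists n, thicken n.+1%:R^-1 K `<=` C) ->
  forall n, exists p : set RN * R * (RN * R -> R),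
  let V := p.1.1 in let M := p.1.2 in let zeta := p.2 in
  [/\ open V, V `<=` C, (lam V <= (n.+1%:R^-1 ^+ 2)%:E)%E, n.+1%:R <= M & [/\
    C21_l0 Om T zeta, forall x, K x -> zeta (x, 0) = 1,
    forall x t, 0 <= t -> 0 <= zeta (x, t) <= 1,
    forall x t, 0 <= t -> ~ V x \/ M^-1 <= t ->
      zeta (x, t) = 0 /\ dt zeta (x, t) + laplacian zeta (x, t) = 0 &
    forall x t, 0 <= t <= T ->
      dt zeta (x, t) + laplacian zeta (x, t) <= n.+1%:R^-1 /\
      `|dt zeta (x, t) + laplacian zeta (x, t)| <= 12 * M]].
Proof.
move=> cK K0 cC COm [n0 n0C] n.
have [r1 r1_gt0 Or1] := bounded_sub_ball bOm.
have lamC : (lam C < +oo)%E.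
  apply: le_lt_trans (is_lebesgue_ball r1 Hlam).
  apply: le_measure; rewrite ?inE; first exact: compact_measurable_rV.
    by apply: open_measurable_rV; exact: ball_open.
  exact: subset_trans Or1.
(* Shifting the index by [n0] keeps every neighbourhood inside [C], so their measures are finite. *)
pose F k := thicken (k + n0).+1%:R^-1 K.
have mF k : measurable (F k) by apply: open_measurable_rV; exact: thicken_open.
have FC k : F k `<=` C.
  by apply: subset_trans n0C; apply: thicken_nd; exact: leq_addl.
have ndF : {homo F : k l / (k <= l)%N >-> l `<=` k}.
  by move=> k l kl; apply: thicken_nd; rewrite leq_add2r.
have FK : \bigcap_k F k `<=` K.
  rewrite -[X in _ `<=` X](thicken_bigcap (compact_closed_rV cK)).
  by move=> x h k _; apply: (thicken_nd (leq_addr n0 k)); exact: h.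
have [||k lamF] := @near_lt_measure _ _ lam F (n.+1%:R^-1 ^+ 2) _ mF ndF.
- apply: le_lt_trans lamC; apply: le_measure; rewrite ?inE//.
  exact: compact_measurable_rV.
- apply: (@le_lt_trans _ _ (lam K)).
    apply: le_measure; rewrite ?inE//; first exact: bigcapT_measurable.
    exact: compact_measurable_rV.
  by rewrite K0 lte_fin exprn_gt0.
have oF : open (F k) by exact: thicken_open.
have KF : K `<=` F k by exact: sub_thicken.
have n1 : 0 < n.+1%:R^-1 :> R by [].
(* The summand 1/T in the lower bound for [M] gives 1/M <= T, so [zeta] vanishes at the final
   time. *)
have [M [zeta [M0M M0 Cz zK [z01 zout zh]]]] :=
  @C21_test_function R N K (F k) C n.+1%:R^-1 T (n.+1%:R + T^-1) cK oF KF cC (FC k) n1 T0.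
exists (F k, M, zeta); split => //=.
  by rewrite (le_trans _ M0M)// lerDl invr_ge0 ltW.
split => //.
have MT : M^-1 <= T by rewrite invf_ple ?posrE// (le_trans _ M0M)// lerDr.
split; [exact: C21_C21_closure|split].
- move=> x t [_ nOx] /andP[t0 _].
  by have [] := zout x t t0 (or_introl (fun Fx => nOx (COm _ (FC k _ Fx)))).
- by move=> x _; have [] := zout x T (ltW T0) (or_intror MT).
Qed.

(** Three ranges of [u]: for u <= 0 the one-sided bound on [h] gives |u|/(n+1); for 0 < u < n+1 the
    product is at most 12 M (n+1); for u >= n+1 it is absorbed by [g]. The second copy of [g] comes
    from z g. *)
Lemma test_integrand_bound (n : nat) (M u g h z : R) : 0 <= z <= 1 -> 0 <= M ->
  h <= n.+1%:R^-1 -> `|h| <= 12 * M -> 0 <= g -> 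
  (n.+1%:R <= u -> 12 * M * u <= g) ->
  - u * h + z * g <= n.+1%:R^-1 * `|u| + 12 * M * n.+1%:R + 2 * g.
Proof.
move=> /andP[z0 z1] M0 hn hM g0 gu.
have zg : z * g <= g by rewrite ler_piMl.
have n0 : 0 <= 12 * M * n.+1%:R by rewrite !mulr_ge0.
have un : n.+1%:R > u -> 0 <= u -> 12 * M * u <= 12 * M * n.+1%:R.
  by move=> /ltW ? ?; rewrite ler_wpM2l// mulr_ge0.
have e0 : 0 <= n.+1%:R^-1 :> R by [].
move: n.+1%:R^-1 (12 * M * n.+1%:R) hn n0 un e0 => a c hn n0 un e0.
have au0 : 0 <= a * `|u| by rewrite mulr_ge0.
suff : - u * h <= a * `|u| + c + g by lra.
have [u0|u0] := leP u 0.
  have : - u * h <= - u * a by rewrite ler_wpM2l// oppr_ge0.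
  by rewrite (ler0_norm u0); lra.
have uh : - u * h <= 12 * M * u.
  rewrite mulNr -mulrN mulrC ler_pM2r//.
  by apply: le_trans hM; rewrite -normrN ler_norm.
have [/gu|/un/(_ (ltW u0))] := leP n.+1%:R u; lra.
Qed.

Lemma good_measure_null_compact (mu : {measure set RN -> \bar R}) (K : set RN) :
  (forall g : R -> R, continuous g -> {homo g : x y / x <= y} ->
     (forall s, s <= 0 -> g s = 0) -> good_measure Om T lam g mu) ->
  compact K -> K `<=` Om -> lam K = 0%E -> mu K = 0%E.
Proof.
move=> good cK KOm K0.
have [n0 n0K] := compact_thicken_sub cK oOm KOm.
set r : R := n0.+1%:R^-1 in n0K.
have r0 : 0 < r by rewrite invr_gt0.
pose C := erosion r Om.
have cC : compact C by exact: compact_erosion.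
have COm : C `<=` Om by exact: erosion_sub.
have /choice[p pP] := exists_test_sequence cK K0 cC COm (ex_intro (fun n => thicken n.+1%:R^-1 K `<=` C) n0 n0K).
pose V n := (p n).1.1; pose M n := (p n).1.2; pose zeta n := (p n).2.
have M_ge n : n.+1%:R <= M n by case: (pP n).
have M0 n : 0 < M n by apply: lt_le_trans (M_ge n).
(* The rates [M n] depend on [K] but not on a solution, so a single [g] can be fixed for all n
   before [u] is obtained from it. *)
have [|g [cg ndg g0 gM]] := @exists_fast_growing R (fun n => 12 * M n).
  by move=> n; rewrite mulr_ge0// ltW.
have g_ge0 s : 0 <= g s.
  have [s0|/ltW s0] := leP s 0; first by rewrite g0.
  by rewrite -(g0 0 (lexx _)); exact: ndg.
have [u [iu [gu weak]]] := good g cg ndg g0.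
have iG := L1rho_integrable r0 gu.
set G := _ \_ _ in iG.
have mG : measurable_fun setT G by apply/measurable_EFinP; exact: measurable_int iG.
have G0 z : 0 <= G z by rewrite /G patchE; case: ifP => _ /=; [exact: g_ge0|exact: lexx].
pose E n := V n `*` `]0, (M n)^-1[%classic `&` QT Om T.
have mV n : measurable (V n) by apply: open_measurable_rV; case: (pP n).
have mE n : measurable (E n).
  by apply: measurableI => //; apply: measurableX => //; exact: measurable_itv.
have EQ n : E n `<=` QT Om T by move=> ? [].
have mEn n : (m (E n) <= (n.+1%:R^-1 ^+ 2 / M n)%:E)%E.
  apply: (@le_trans _ _ (m (V n `*` `]0, (M n)^-1[%classic))).
    have mVM : measurable (V n `*` `]0, (M n)^-1[%classic).
      by apply: measurableX => //; exact: measurable_itv.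
    by apply: (@le_measure _ _ _ m _ _ (mem_set (mE n)) (mem_set mVM)) => ? [].
  have -> : m (V n `*` `]0, (M n)^-1[%classic) =
      (lam (V n) * (@lebesgue_measure R) `]0%R, ((M n)^-1)%R[%classic)%E.
    by apply: (@product_measure1E _ _ RN (measurableTypeR R) R lam (@lebesgue_measure R)) => //; exact: measurable_itv.
  rewrite lebesgue_measure_itv/= lte_fin invr_gt0 M0 oppr0 adde0 EFinM.
  rewrite lee_wpmul2r//; first by rewrite lee_fin invr_ge0 ltW.
  by case: (pP n).
have iU : (\int[m]_(z in QT Om T) `|(u z)%:E| < +oo)%E by case/integrableP: iu.
set U := (\int[m]_(z in QT Om T) `|(u z)%:E|)%E in iU.
have key n : (mu K <= n.+1%:R^-1%:E * U + (12 * n.+1%:R^-1)%:E +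
    2%:E * \int[m]_(z in E n) (G z)%:E)%E.
  have [oV VC lamV nM [Cz zK z01 zout zh]] := pP n.
  apply: (@le_trans _ _ (\int[mu]_(x in Om) (zeta n (x, 0))%:E)%E).
    apply: mu_le_integral => //; first exact: open_measurable_rV.
      exact: compact_measurable_rV.
    by move=> x _; case/andP: (z01 x 0 (lexx _)).
  rewrite -weak//.
  have := @integral_bound _ _ _ m (QT Om T) (E n) u G _ n.+1%:R^-1 (12 * M n * n.+1%:R)
    measurable_QT (mE n) (EQ n) iu mG G0.
  move=> /(_ (fun z => - u z * dt (zeta n) z - u z * laplacian (zeta n) z +
    zeta n z * g (u z))).
  have a0 : 0 <= n.+1%:R^-1 :> R by rewrite invr_ge0.
  have c0 : 0 <= 12 * M n * n.+1%:R by rewrite !mulr_ge0// ltW.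
  move=> /(_ a0 c0) h; apply: le_trans (h _) _.
    move=> [x t] [/= Omx]; rewrite in_itv/= => /andP[t0 tT].
    rewrite -mulNr -mulrDr.
    (* On [E n] the pointwise bound applies; elsewhere in the cylinder both [zeta n] and its image
       under d/dt + Laplacian vanish, and with them the integrand. *)
    have [[Vx tM]|nE] := pselect (V n x /\ t < (M n)^-1).
      have t0T : 0 <= t <= T by rewrite (ltW t0) ltW.
      have [h1 h2] := zh x t t0T.
      have Ext : E n (x, t) by split; split => //=; rewrite in_itv/= t0.
      have Cxt : (C `*` `]0, T[%classic) (x, t).
        by split; [exact: VC|rewrite /= in_itv/= t0].
      rewrite indicE (mem_set Ext) /G patchE (mem_set Cxt).
      rewrite !mulr1; apply: test_integrand_bound => //.
      - exact/z01/ltW.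
      - exact: ltW.
      - exact: gM.
    have [z0 h0] : zeta n (x, t) = 0 /\ dt (zeta n) (x, t) + laplacian (zeta n) (x, t) = 0.
      apply: zout; first exact: ltW.
      have [Vx|] := pselect (V n x); last by left.
      by right; rewrite leNgt; apply/negP => tM; apply: nE.
    have i0 : 0 <= \1_(E n) (x, t) :> R by rewrite indicE.
    rewrite z0 h0 mulr0 mul0r addr0; apply: addr_ge0.
      by apply: addr_ge0; apply: mulr_ge0.
    by do 2 apply: mulr_ge0 => //.
  apply: leeD => //; apply: leeD => //.
  apply: le_trans (lee_wpmul2l _ (mEn n)) _; first by rewrite lee_fin !mulr_ge0 ?ltW.
  rewrite -EFinM lee_fin le_eqVlt; apply/orP; left; apply/eqP.
  have nz : n.+1%:R != 0 :> R by rewrite pnatr_eq0.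
  have Mn0 : M n != 0 by rewrite gt_eqF.
  move: (n.+1%:R : R) (M n) nz Mn0 => a b az bz.
  by field; rewrite az bz.
apply/eqP; rewrite eq_le measure_ge0 andbT; apply/lee_addgt0Pr => e e0; rewrite add0e.
(* The integral of [G] carries the coefficient 2, so e/4 uses half of the budget; the other half is
   for the terms in 1/(n+1). *)
have e4 : 0 < e / 4 by rewrite divr_gt0.
have [d d0 dG] := integral_small_measure iG G0 e4.
have Ufin : U \is a fin_num by rewrite ge0_fin_numE ?integral_ge0.
have U0 : 0 <= fine U by rewrite fine_ge0 ?integral_ge0.
(* The first summand makes (|u|_1 + 12)/(n+1) at most e/2; the second makes 1/(n+1), and hence the
   measure of [E n], smaller than [d]. *)
pose n := Num.bound (2 * (fine U + 12) / e + d^-1).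
have nb : 2 * (fine U + 12) / e + d^-1 < n.+1%:R.
  apply: lt_trans (archi_boundP _) _; last by rewrite ltr_nat.
  by rewrite addr_ge0 ?invr_ge0 ?(ltW d0)// divr_ge0 ?(ltW e0)// mulr_ge0// addr_ge0.
have nd : n.+1%:R^-1 < d.
  rewrite invf_plt ?posrE//; apply: le_lt_trans nb; rewrite lerDr.
  by rewrite divr_ge0 ?(ltW e0)// mulr_ge0// addr_ge0.
have ne : n.+1%:R^-1 * (fine U + 12) <= e / 2.
  rewrite ler_pdivrMl// -ler_pdivrMr ?divr_gt0// invf_div mulrCA mulrA ltW//.
  by apply: le_lt_trans nb; rewrite lerDl invr_ge0 ltW.
have n1 : n.+1%:R^-1 <= 1 :> R by rewrite invf_ple ?posrE// invr1 ler1n.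
have mEd : (m (E n) < d%:E)%E.
  apply: (le_lt_trans (mEn n)); rewrite lte_fin; apply: le_lt_trans nd.
  have Mi0 : 0 <= (M n)^-1 by rewrite invr_ge0 ltW.
  have Mi1 : (M n)^-1 <= 1.
    by rewrite invf_ple ?posrE// invr1 (le_trans _ (M_ge n))// ler1n.
  by rewrite expr2 -mulrA ler_piMr// mulr_ile1.
apply: (le_trans (key n)).
apply: (@le_trans _ _ (n.+1%:R^-1%:E * U + (12 * n.+1%:R^-1)%:E + 2%:E * (e / 4)%:E)%E).
  apply: leeD; first exact: lexx.
  apply: lee_wpmul2l; first by rewrite lee_fin.
  exact: (dG _ (mE n) mEd).
rewrite -(fineK Ufin) -!EFinM -!EFinD lee_fin.
by move: ne; rewrite mulrDr; move: (n.+1%:R^-1 : R) (fine U) => a f; lra.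
Qed.

End null_compact.

(** * Density *)

Section density.
Context d (X : measurableType d) (R : realType).
Implicit Types lam mu : {measure set X -> \bar R}.

(* An alias of [lam] carrying a sigma-finite measure structure. *)
Definition with_sigma_finite lam of sigma_finite setT lam : set X -> \bar R := lam.

Section instances.
Variables (lam : {measure set X -> \bar R}) (H : sigma_finite setT lam).
HB.instance Definition _ := Measure.copy (with_sigma_finite H) lam.
HB.instance Definition _ := Measure_isSigmaFinite.Build _ _ _ (with_sigma_finite H) H.
End instances.

(** Radon-Nikodym is applied to the finite restriction of [mu] to each piece, and the densities are
    glued. The last clause, by change of variables on each piece, transfers the weighted integral
    from [mu] to the density. *)
Lemma density_on_partition (lam : {sigma_finite_measure set X -> \bar R})
    (mu : {measure set X -> \bar R}) (D : (set X)^nat) (w : X -> R) :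
  (forall k, measurable (D k)) -> trivIset setT D ->
  (forall k, (mu (D k) < +oo)%E) ->
  (forall A, measurable A -> A `<=` \bigcup_k D k -> lam A = 0%E -> mu A = 0%E) ->
  measurable_fun setT w -> (forall x, 0 <= w x) ->
  exists f : X -> R, [/\ measurable_fun (\bigcup_k D k) f, forall x, 0 <= f x,
    forall A, measurable A -> A `<=` \bigcup_k D k ->
      mu A = (\int[lam]_(x in A) (f x)%:E)%E &
    (\int[lam]_(x in \bigcup_k D k) (f x * w x)%:E =
     \int[mu]_(x in \bigcup_k D k) (w x)%:E)%E].
Proof.
move=> mD tD muD ac mw w0.
pose nu k : {finite_measure set X -> \bar R} := mfrestr (mD k) (muD k).
have nuE k A : measurable A -> A `<=` D k -> nu k A = mu A.
  by move=> mA AD; rewrite /nu /= /mfrestr /mrestr setIidl.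
have nulam k : nu k `<< lam.
  apply/null_content_dominatesP => A mA A0.
  rewrite /nu /= /mfrestr /mrestr; apply: ac; first exact: measurableI.
    by move=> x [_ Dx]; exists k.
  by apply: (subset_measure0 (measurableI _ _ mA (mD k)) mA) A0; exact: subIsetl.
pose g k := Radon_Nikodym_SigmaFinite.f (nu k) lam.
have g0 k x : (0 <= g k x)%E by exact: Radon_Nikodym_SigmaFinite.f_ge0.
have gfin k x : g k x \is a fin_num by exact: Radon_Nikodym_SigmaFinite.f_fin_num.
have mg k : measurable_fun setT (g k).
  exact: measurable_int (Radon_Nikodym_SigmaFinite.f_integrable (nulam k)).
(* [xget] picks the index of the piece containing [x], unique by disjointness; off the union it
   defaults to 0. *)
pose f x := fine (g (xget 0%N [set k | D k x]) x).
have f0 x : 0 <= f x by exact: fine_ge0.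
have fE k x : D k x -> (f x)%:E = g k x.
  move=> Dx; rewrite /f fineK//; case: xgetP => [j _ Dj|/(_ k)//].
  have -> // : j = k by apply: tD => //; exists x.
have mf : measurable_fun (\bigcup_k D k) f.
  apply/measurable_fun_bigcup => // k; apply/measurable_EFinP.
  apply: (eq_measurable_fun (g k)); last exact: measurable_funTS.
  by move=> x /set_mem Dx; rewrite /= (fE k).
have mbD : measurable (\bigcup_k D k) by exact: bigcupT_measurable.
exists f; split => //.
- move=> A mA AD.
  have AE : A = \bigcup_k (A `&` D k) by rewrite -setI_bigcupr setIidl.
  have mAD k : measurable (A `&` D k) by exact: measurableI.
  have tAD : trivIset setT (fun k => A `&` D k) by exact: trivIset_setIl.
  rewrite [in RHS]AE ge0_integral_bigcup//; last 2 first.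
  + by rewrite -AE; apply/measurable_EFinP; exact: measurable_funS mf.
  + by move=> x _; rewrite lee_fin.
  rewrite [in LHS]AE measure_bigcup//.
  rewrite (@eq_eseriesl _ _ xpredT); last by move=> k; rewrite in_setT.
  apply: eq_eseriesr => k _.
  rewrite -(nuE k (A `&` D k))//.
  rewrite (Radon_Nikodym_SigmaFinite.f_integral (nulam k))//.
  by apply: eq_integral => x /set_mem[_ Dx]; rewrite (fE k).
- rewrite !ge0_integral_bigcup//; last 4 first.
  + by apply/measurable_EFinP; exact: measurable_funTS.
  + by move=> x _; rewrite lee_fin.
  + by apply/measurable_EFinP; apply: measurable_funM => //; exact: measurable_funTS.
  + by move=> x _; rewrite lee_fin mulr_ge0.
  apply: eq_eseriesr => k _.
  transitivity (\int[nu k]_(x in D k) (w x)%:E)%E; last first.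
    by apply: eq_measure_integral; exact: nuE.
  have w0' x : (0 <= (w x)%:E)%E by rewrite lee_fin.
  rewrite -(Radon_Nikodym_SigmaFinite.change_of_variables (nulam k) w0' (mD k)); last first.
    by apply/measurable_EFinP; exact: measurable_funTS.
  apply: eq_integral => x /set_mem Dx.
  by rewrite EFinM (fE k)// muleC.
Qed.

End density.

(** * From compact null sets to Borel null sets *)

Section absolute_continuity.
Context {R : realType} {N : nat}.
Local Notation RN := 'rV[R]_N.
Context (Om : set RN) (mu : {measure set RN -> \bar R}).
Hypotheses (oOm : open Om) (bOm : bounded_set Om)
  (muK : forall K : set RN, compact K -> K `<=` Om -> (mu K < +oo)%E).

Let C n := erosion n.+1%:R^-1 Om.

Let cC n : compact (C n). Proof. exact: compact_erosion. Qed.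

Let COm n : C n `<=` Om. Proof. exact: erosion_sub. Qed.

Let mC n : measurable (C n). Proof. exact: compact_measurable_rV. Qed.

(** On each compact [C n] the restriction of [mu] is finite, hence inner regular by closed sets. A
    closed subset of [C n] is compact, so it carries no mass by hypothesis, and the sets [C n]
    exhaust [Om]. *)
Lemma null_of_null_compact (A : set RN) : measurable A -> A `<=` Om ->
  (forall K : set RN, compact K -> K `<=` A -> mu K = 0%E) -> mu A = 0%E.
Proof.
move=> mA AOm A0.
have AC n : mu (A `&` C n) = 0%E.
  have muC : (mu (C n) < +oo)%E by exact: muK.
  pose nu : {finite_measure set RN -> \bar R} := mfrestr (mC n) muC.
  have mAC : measurable (A `&` C n) by exact: measurableI.
  apply/eqP; rewrite eq_le measure_ge0 andbT; apply/lee_addgt0Pr => e e0; rewrite add0e.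
  have [F [cF FAC nuF]] := closed_inner_regular nu mAC e0.
  have cpF : compact F.
    by apply: (subclosed_compact cF (@cC n)) => x /FAC[].
  have F0 : mu F = 0%E.
    by apply: A0 => // x /FAC[].
  have mF : measurable F by exact: closed_measurable_rV.
  have mACF : measurable ((A `&` C n) `\` F) by exact: measurableD.
  rewrite -(setDUK FAC) measureU//; last by rewrite setDIK.
  rewrite -[leLHS]/(mu F + mu (A `&` C n `\` F))%E F0 add0e.
  apply: le_trans nuF; rewrite /nu /= /mfrestr /mrestr.
  by rewrite [X in (_ <= mu X)%E]setIidl// => x [[]].
apply/eqP; rewrite eq_le measure_ge0 andbT.
have AE : A = \bigcup_n (A `&` C n).
  by rewrite -setI_bigcupr erosion_bigcup// setIidl.
apply: (@le_trans _ _ (\sum_(n <oo) mu (A `&` C n))%E).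
  apply: measure_sigma_subadditive => //; last by rewrite -AE.
  by move=> n; exact: measurableI.
by rewrite eseries0// => n _ _; exact: AC.
Qed.

End absolute_continuity.

(** * Absolute continuity of the measure and weighted integrability of its density *)

Unset Implicit Arguments. Set Strict Implicit. Set Printing Implicit Defensive.
Theorem theorem2p23 (R : realType) (N : nat) (Om : set 'rV[R]_N) (T : R)
  (lam : {measure set 'rV[R]_N -> \bar R}) (mu : {measure set 'rV[R]_N -> \bar R}) :
  (1 <= N)%N -> bounded_domain Om -> 0 < T -> is_lebesgue_RN lam ->
  M1plus Om mu ->
  (forall g : R -> R, continuous g -> {homo g : x y / x <= y} ->
     (forall s, s <= 0 -> g s = 0) -> good_measure Om T lam g mu) ->
  in_L1rho_measure Om lam mu.
Proof.
move=> N1 [Om0 [oOm [_ bOm]]] T0 Hlam [_ [muK murho]] good.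
have bdOm := boundary_neq0 N1 Om0 oOm bOm.
have mOm : measurable Om by exact: open_measurable_rV.
have sf := is_lebesgue_sigma_finite Hlam.
have ac A : measurable A -> A `<=` Om -> lam A = 0%E -> mu A = 0%E.
  move=> mA AOm lamA; apply: (null_of_null_compact oOm bOm muK) => // K cK KA.
  apply: (good_measure_null_compact oOm bOm bdOm T0 Hlam good cK).
    exact: subset_trans KA AOm.
  by apply: (subset_measure0 (compact_measurable_rV cK) mA KA).
pose C n := erosion n.+1%:R^-1 Om.
have cC n : compact (C n) by exact: compact_erosion.
have mC n : measurable (C n) by exact: compact_measurable_rV.
(* Successive differences of the compact exhaustion partition [Om] into pieces of finite
   [mu]-measure. *)
pose D := seqDU C.
have DE : \bigcup_n D n = Om by rewrite /D -seqDU_bigcup_eq erosion_bigcup.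
have mD n : measurable (D n) by apply: seqDU_measurable.
have muD n : (mu (D n) < +oo)%E.
  apply: (@le_lt_trans _ _ (mu (C n))).
    by apply: le_measure; rewrite ?inE//; exact: subset_seqDU.
  by apply: muK => //; exact: erosion_sub.
have := @density_on_partition _ _ _ (with_sigma_finite sf) mu D (rho Om) mD
  (trivIset_seqDU C) muD.
rewrite DE => /(_ ac (@measurable_rho R N Om) (@rho_ge0 R N Om)) [f [mf f0 fmu fw]].
exists f; split => //; split => //.
under eq_integral do rewrite ger0_norm//.
(* The weighted integral of [f] equals that of [rho] against [mu], finite by the definition of
   [M1plus]. *)
by rewrite -[X in (X < _)%E]/(\int[with_sigma_finite sf]_(x in Om) (f x * rho Om x)%:E)%E fw.
Qed.
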